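(* Let $\mathbf{A}$ be a finite algebra with a Mal'cev term, and let $\mathbb{L}$ be the congruence lattice of $\mathbf{A}$. If $\mathbb{L}$ is simple, then the following are equivalent: (1) $\mathrm{Comp}(\mathbf{A})$ is finitely generated; (2) $\mathbb{L}$ does not split, or $|\mathbb{L}|\le 2$.
   Context: An algebra is a pair $\mathbf{A}=(A,F)$ with $A$ a nonempty set and $F$ a family of finitary operations on $A$. A Mal'cev term is a ternary term whose term function $m$ satisfies $m(x,x,y)=y=m(y,x,x)$ for all $x,y\in A$. A function $f:A^k\to A$ is congruence preserving if for every congruence $\alpha$ of $\mathbf{A}$ and all $(a_1,b_1),\dots,(a_k,b_k)\in\alpha$ we have $(f(a_1,\dots,a_k),f(b_1,\dots,b_k))\in\alpha$; $\mathrm{Comp}(\mathbf{A})$ is the clone of all congruence preserving functions of arities $k\ge1$. It is finitely generated if it has a finite subset $F$ such that each of its members is a composition of projections and functions in $F$. A lattice is simple if it has no lattice congruences other than the equality relation and the total relation. A bounded lattice $\mathbb{L}$ with least element $\mathbf 0$ and greatest element $\mathbf 1$ splits if there are $\delta,\varepsilon\in\mathbb{L}$ with $\delta<\mathbf 1$, $\varepsilon>\mathbf 0$ such that every $\alpha\in\mathbb{L}$ satisfies $\alpha\le\delta$ or $\alpha\ge\varepsilon$. *)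

(* Defs.v *)
From HB Require Import structures.
From mathcomp Require Import all_boot all_order boolp.

Set Implicit Arguments.
Unset Strict Implicit.
Unset Printing Implicit Defensive.

Import Order.TTheory.

Definition operation (T : finType) (k : nat) := {ffun k.-tuple T -> T}.

(* The family of basic operations is arbitrary: possibly infinite, and nullary
   operations are allowed. *)
Record finAlgebra := FinAlgebra {
  carrier :> finType;
  symbol : Type;
  arity : symbol -> nat;
  basic : forall s : symbol, operation carrier (arity s);
  carrier_gt0 : 0 < #|carrier|
}.

Inductive term (A : finAlgebra) (n : nat) : Type :=
| Var (i : 'I_n)
| App (s : symbol A) (args : 'I_(arity s) -> term A n).

Fixpoint eval (A : finAlgebra) (n : nat) (x : n.-tuple A) (t : term A n) : A :=
  match t with
  | Var i => tnth x i
  | App s args => basic s [tuple eval x (args i) | i < arity s]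
  end.

Definition malcev_term (A : finAlgebra) (t : term A 3) : Prop :=
  forall x y : A, eval [tuple x; x; y] t = y /\ eval [tuple y; x; x] t = y.

Definition has_malcev_term (A : finAlgebra) : Prop :=
  exists t : term A 3, malcev_term t.

Definition preserves (T : finType) (k : nat) (f : operation T k)
    (r : {set T * T}) : Prop :=
  forall x y : k.-tuple T,
    (forall i, (tnth x i, tnth y i) \in r) -> (f x, f y) \in r.

Definition is_congruence (A : finAlgebra) (r : {set A * A}) : Prop :=
  equivalence_rel (fun x y => (x, y) \in r) /\
  forall s : symbol A, preserves (basic s) r.

Record congruence (A : finAlgebra) := Congruence {
  cong_set :> {set A * A};
  congruenceb : `[< is_congruence cong_set >]
}.

HB.instance Definition _ (A : finAlgebra) := [isSub for @cong_set A].
HB.instance Definition _ (A : finAlgebra) := [Finite of congruence A by <:].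

Section CongruenceLattice.
Variable A : finAlgebra.
Implicit Types a b c : congruence A.

Lemma congruenceP a : is_congruence a.
Proof. by apply/asboolP/congruenceb. Qed.

Lemma is_congruence_bigcap (P : {pred congruence A}) :
  is_congruence (\bigcap_(c in P) (c : {set A * A})).
Proof.
split=> [x y z|s x y xy].
  split=> [|xy].
    by apply/bigcapP => c _; have [/(_ x y z)[]] := congruenceP c.
  apply/bigcapP/bigcapP => h c cP; move/bigcapP: xy => /(_ c cP) xyc;
    have := h c cP; have [/(_ x y z)[_ /(_ xyc)]] := congruenceP c;
    by move=> ->.
apply/bigcapP => c cP; have [_ /(_ s x y)] := congruenceP c; apply.
by move=> i; move/bigcapP: (xy i); apply.
Qed.

Definition cong_bigcap (P : {pred congruence A}) : congruence A :=
  Congruence (asboolT (is_congruence_bigcap P)).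

Definition cong_le a b : bool := (a : {set A * A}) \subset b.
Definition cong_meet a b : congruence A := cong_bigcap (pred2 a b).
Definition cong_join a b : congruence A :=
  cong_bigcap [pred c | cong_le a c & cong_le b c].
Definition cong_bot : congruence A := cong_bigcap predT.
Definition cong_top : congruence A := cong_bigcap pred0.

Lemma cong_le_refl : reflexive cong_le. Proof. by move=> a; apply: subxx. Qed.

Lemma cong_le_anti : antisymmetric cong_le.
Proof. by move=> a b ab; apply/val_inj/eqP; rewrite eqEsubset. Qed.

Lemma cong_le_trans : transitive cong_le.
Proof. by move=> b a c; apply: subset_trans. Qed.

Lemma cong_meetP a b c :
  cong_le a (cong_meet b c) = cong_le a b && cong_le a c.
Proof.
apply/bigcapsP/andP => [h|[ab ac] d].
  by split; apply: h; rewrite inE eqxx ?orbT.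
by rewrite inE => /orP[] /eqP ->.
Qed.

Lemma cong_joinP a b c :
  cong_le (cong_join a b) c = cong_le a c && cong_le b c.
Proof.
apply/idP/andP => [h|[ac bc]]; last by apply: bigcap_inf; rewrite inE ac.
by split; apply: cong_le_trans h; apply/bigcapsP => d; rewrite inE => /andP[].
Qed.

Lemma cong_le0x a : cong_le cong_bot a. Proof. exact: bigcap_inf. Qed.

Lemma cong_lex1 a : cong_le a cong_top. Proof. exact/bigcapsP. Qed.

End CongruenceLattice.

Fact cong_display : Order.disp_t. Proof. exact: Order.Disp tt tt. Qed.

HB.instance Definition _ (A : finAlgebra) :=
  Order.Le_isPOrder.Build cong_display (congruence A)
    (@cong_le_refl A) (@cong_le_anti A) (@cong_le_trans A).
HB.instance Definition _ (A : finAlgebra) :=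
  Order.POrder_MeetJoin_isLattice.Build cong_display (congruence A)
    (@cong_meetP A) (@cong_joinP A).
HB.instance Definition _ (A : finAlgebra) :=
  Order.hasBottom.Build cong_display (congruence A) (@cong_le0x A).
HB.instance Definition _ (A : finAlgebra) :=
  Order.hasTop.Build cong_display (congruence A) (@cong_lex1 A).

Section CongruenceLatticeTheory.
Variable A : finAlgebra.
Implicit Types a b : congruence A.

Lemma cong_leE a b : (a <= b)%O = ((a : {set A * A}) \subset b).
Proof. by []. Qed.

Lemma cong_meetE a b : (a `&` b)%O = (a : {set A * A}) :&: b :> {set A * A}.
Proof.
apply/setP => p; rewrite inE; apply/bigcapP/andP => [h|[pa pb] d].
  by split; apply: h; rewrite inE eqxx ?orbT.
by rewrite inE => /orP[] /eqP ->.
Qed.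

Lemma cong_botE :
  (\bot%O : congruence A) = [set p : A * A | p.1 == p.2] :> {set A * A}.
Proof.
have diagP : is_congruence [set p : A * A | p.1 == p.2].
  split=> [x y z|s x y xy]; first by rewrite !inE; split=> // /eqP /= ->.
  rewrite inE /=; apply/eqP; congr (basic s _); apply: eq_from_tnth => i.
  by have := xy i; rewrite inE => /eqP.
apply/eqP; rewrite eqEsubset; apply/andP; split.
  exact: (@cong_le0x A (Congruence (asboolT diagP))).
apply/subsetP => -[x y]; rewrite inE /= => /eqP <-.
by have [/(_ x x x)[]] := congruenceP (\bot%O : congruence A).
Qed.

Lemma cong_topE : (\top%O : congruence A) = [set: A * A] :> {set A * A}.
Proof. exact: big_pred0_eq. Qed.

End CongruenceLatticeTheory.

Section Lattices.
Context {d : Order.disp_t}.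

Definition lattice_congruence (L : latticeType d) (r : rel L) : Prop :=
  equivalence_rel r /\
  forall x x' y y' : L, r x x' -> r y y' ->
    r (x `&` y)%O (x' `&` y')%O /\ r (x `|` y)%O (x' `|` y')%O.

(* The one-element lattice counts as simple. *)
Definition simple_lattice (L : latticeType d) : Prop :=
  forall r : rel L, lattice_congruence r ->
    (forall x y, r x y = (x == y)) \/ (forall x y, r x y).

Definition splits (L : tbLatticeType d) : Prop :=
  exists delta epsilon : L,
    [/\ (delta < \top)%O, (\bot < epsilon)%O &
        forall a : L, (a <= delta)%O \/ (epsilon <= a)%O].

End Lattices.

Definition opset (T : finType) := forall k : nat, operation T k -> Prop.

Inductive composition_of (T : finType) (F : opset T) (k : nat) :
    operation T k -> Prop :=
| Projection (i : 'I_k) :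
    composition_of F [ffun x : k.-tuple T => tnth x i]
| Composition (n : nat) (f : operation T n) (g : 'I_n -> operation T k) :
    F n f -> (forall i, composition_of F (g i)) ->
    composition_of F [ffun x : k.-tuple T => f [tuple g i x | i < n]].

Definition Comp (A : finAlgebra) : opset A := fun k f =>
  0 < k /\ forall a : congruence A, preserves f a.
Arguments Comp : clear implicits.

Definition finitely_generated (T : finType) (C : opset T) : Prop :=
  exists s : seq {k : nat & operation T k},
    let F : opset T := fun k f => Tagged (operation T) f \in s in
    (forall k (f : operation T k), F k f -> C k f) /\
    (forall k (f : operation T k), C k f -> composition_of F f).

(* Main.v *)
From HB Require Import structures.
Require Import Defs.
From mathcomp Require Import all_boot all_order all_algebra all_fingroup.
From mathcomp Require Import all_solvable mxabelem boolp ring.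

(** The Mal'cev operation m makes congruences permute, so that the congruence
    lattice L is modular, and it lets one subtract: m f g h is h where f = g, and
    f where g = h. The statement is about the clone Comp(A) of all congruence
    preserving functions, not about the term functions of A.

    If L does not split, Comp(A) is generated by its members of bounded arity. Call
    a function d absorbing if it takes the value e as soon as one argument x_i equals
    o_i; its type is the list of congruences relating o_i to a point p_i with
    d(p) <> e. If absorbing functions of unbounded arity existed, choose a set X of
    congruences, containing the greatest one, that is maximal among the sets all of
    whose members can occur together arbitrarily often in such a type. The type
    behaves additively under joins (absorbing_join), hence the complement of X is
    closed under joins and has a greatest element delta; and e, d(p) are related
    by all members of X, so their meet epsilon is not the equality. Then L splits
    (nonvanishing_splits). Consequently there is a K such that two members of
    Comp(A) are equal if they agree on all tuples with fewer than K entries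
    different from a fixed o (eq_small_support: on a minimal support where they
    differ, their difference is absorbing), and each function can be interpolated
    on these tuples by m and functions of few arguments
    (interpolate_small_supports). If L has at most two elements, Comp(A) consists
    of all functions of positive arity, and binary functions generate them.

    Conversely let L split, be simple, and have more than two elements. In a simple
    modular lattice a property of covers that is invariant under transposition
    holds for all covers as soon as it holds for one
    (simple_projectively_invariant). Applied to the term condition, this shows that
    every cover is central in Comp(A) (simple_central), because the greatest
    congruence is a join of two smaller ones. Over a minimal congruence, centrality
    turns a class into an abelian group, which has a nonzero homomorphism to some
    F_p; the property that a cover is separated by such characters is again
    invariant, hence holds for all covers with the same p (exists_separated).
    By descending from the greatest congruence to the equality, one finds for every
    function from A to F_p and every finite set F of generators a degree d such that
    composing with any composition of F gives a sum of functions of at most d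
    variables, whatever the arity (invariant_bounded): modulo a cover a < b, a
    character is additive up to a function of the classes of b. However, a
    splitting pair delta, epsilon yields the function of any arity k which is e if
    all arguments avoid a class of delta, and o otherwise, where e and o are related
    by epsilon; its alternating sum over a cube does not vanish, as it would for a
    sum of functions of fewer than k variables (sparse_cube). *)

Set Implicit Arguments.
Unset Strict Implicit.
Unset Printing Implicit Defensive.

Import Order.TTheory GRing.Theory.

(** * Covers in a simple modular lattice *)

Section Covers.
Context {disp : Order.disp_t} {L : finTBLatticeType disp}.
Implicit Types x y z t a b : L.
Local Open Scope order_scope.

Definition covers a b :=
  a < b /\ forall z, a <= z -> z <= b -> z = a \/ z = b.

Lemma coverW a b : covers a b -> a <= b. Proof. by case=> /ltW. Qed.

Lemma cover_above x y : x < y -> exists2 z, covers x z & z <= y.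
Proof.
move=> xy; have [n] := ubnP #|[set z | x < z <= y]|.
elim: n y xy => // n IHn y xy; rewrite ltnS => le_n.
have [[z /andP[xz zy]]|noz] := pselect (exists z, x < z < y).
  have [|w cw wz] := IHn z xz; last by exists w => //; apply: le_trans wz (ltW zy).
  apply: leq_trans le_n; apply: proper_card; apply/properP; split.
    by apply/subsetP => w; rewrite !inE => /andP[-> /le_trans-> //]; apply: ltW.
  by exists y; rewrite !inE xy ?lexx // lt_geF.
exists y => //; split=> // z xz zy; have [->|nzx] := eqVneq z x; first by left.
right; apply/eqP/contraT => nzy; case: noz; exists z.
by rewrite !lt_neqAle eq_sym nzx xz nzy.
Qed.

Lemma cover_below x y : x < y -> exists2 z, covers z y & x <= z.
Proof.
move=> xy; have [n] := ubnP #|[set z | x <= z < y]|.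
elim: n x xy => // n IHn x xy; rewrite ltnS => le_n.
have [[z /andP[xz zy]]|noz] := pselect (exists z, x < z < y).
  have [|w cw wz] := IHn z zy; last by exists w => //; apply: le_trans (ltW xz) wz.
  apply: leq_trans le_n; apply: proper_card; apply/properP; split.
    by apply/subsetP => w; rewrite !inE => /andP[/(le_trans (ltW xz))-> ->].
  by exists x; rewrite !inE xy ?lexx // lt_geF.
exists x => //; split=> // z xz zy; have [->|nzx] := eqVneq z x; first by left.
right; apply/eqP/contraT => nzy; case: noz; exists z.
by rewrite !lt_neqAle eq_sym nzx xz nzy.
Qed.

Definition modular_lattice :=
  forall x y z, x <= z -> x `|` (y `&` z) = (x `|` y) `&` z.

Definition transposed a b c d := b `|` c = d /\ b `&` c = a.

Definition projectively_invariant (P : L -> L -> Prop) :=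
  forall a b c d, covers a b -> transposed a b c d -> P a b <-> P c d.

Section Modular.
Hypothesis modL : modular_lattice.

(** A transpose of a cover is a cover, by the isomorphism of the interval from
    b /\ (x \/ a) to b with the interval from x \/ a to x \/ b. *)
Lemma transpose_up a b x :
  covers a b -> b `&` (x `|` a) = a ->
  covers (x `|` a) (x `|` b) /\ transposed a b (x `|` a) (x `|` b).
Proof.
move=> [ab cab] E; have le_ab := ltW ab.
have T : transposed a b (x `|` a) (x `|` b).
  by split=> //; rewrite joinCA (join_l le_ab).
split=> //; split.
  rewrite lt_neqAle leU2 // andbT; apply/eqP => F.
  by move: E ab; rewrite F joinKIC => ->; rewrite ltxx.
move=> z z1 z2.
have zE : z = (x `|` a) `|` (b `&` z).
  by rewrite modL // -joinA (join_r le_ab) (meet_r z2).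
have [||F|F] := cab (b `&` z).
- by rewrite lexI le_ab (le_trans _ z1) // leUr.
- exact: leIl.
- by left; rewrite zE F -joinA joinxx.
- by right; rewrite zE F -joinA (join_r le_ab).
Qed.

Lemma transpose_down a b y :
  covers a b -> a `|` (b `&` y) = b ->
  covers (a `&` y) (b `&` y) /\ transposed (a `&` y) (b `&` y) a b.
Proof.
move=> [ab cab] E; have le_ab := ltW ab.
have T : transposed (a `&` y) (b `&` y) a b.
  by split; [rewrite joinC | rewrite meetAC (meet_r le_ab)].
split=> //; split.
  rewrite lt_neqAle leI2 // andbT; apply/eqP => F.
  by move: E ab; rewrite -F meetKU => ->; rewrite ltxx.
move=> z z1 z2.
have zE : z = (a `|` z) `&` (b `&` y).
  rewrite joinC -modL // meetA (meet_l le_ab).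
  exact/esym/join_l.
have [||F|F] := cab (a `|` z).
- exact: leUl.
- by rewrite leUx le_ab (le_trans z2) // leIl.
- by left; rewrite zE F meetA (meet_l le_ab).
- by right; rewrite zE F meetA meetxx.
Qed.

Section ProjectiveInvariant.
Variable P : L -> L -> Prop.
Hypothesis invP : projectively_invariant P.

(** Collapsing the intervals all of whose covers satisfy P is a lattice
    congruence, because covers inside a union, meet or join of such intervals
    transpose into these intervals. *)
Definition all_covers l h := forall a b, covers a b -> l <= a -> b <= h -> P a b.

Lemma all_covers_sub l h l' h' :
  l <= l' -> h' <= h -> all_covers l h -> all_covers l' h'.
Proof.
by move=> ll hh H a b cab la bh; apply: H => //;
  [apply: le_trans la | apply: le_trans hh].
Qed.

(** A cover of the longer interval transposes up into the upper part if
    meeting it with m collapses it, and down into the lower part otherwise. *)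
Lemma all_covers_cat l m h : l <= m -> m <= h ->
  all_covers l m -> all_covers m h -> all_covers l h.
Proof.
move=> lm mh hl hh a b cab la bh.
have [ab alt] := cab; have le_ab := coverW cab.
have [||b1|b2] := alt (a `|` (b `&` m)); first exact: leUl.
- by rewrite leUx le_ab leIl.
- have [|cu tu] := @transpose_up a b m cab.
    by rewrite joinC meetC -modL // (meetC m).
  apply/(invP cab tu); apply: hh => //; first exact: leUl.
  by rewrite leUx mh.
- have [cd td] := transpose_down cab b2.
  apply/(invP cd td); apply: hl => //; last exact: leIr.
  by rewrite lexI la.
Qed.

Lemma all_covers_meet l h t : l <= h ->
  all_covers l h -> all_covers (l `&` t) (h `&` t).
Proof.
move=> lh H a b cab la; rewrite lexI => /andP[bh bt].
have le_ab := coverW cab.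
have [|cu tu] := @transpose_up a b l cab.
  rewrite meetC joinC -modL //; apply/join_l.
  by apply: le_trans la; rewrite lexI leIl (le_trans (leIr _ _) bt).
apply/(invP cab tu); apply: H => //; first exact: leUl.
by rewrite leUx lh.
Qed.

Lemma all_covers_join l h t : l <= h ->
  all_covers l h -> all_covers (l `|` t) (h `|` t).
Proof.
move=> lh H a b cab; rewrite leUx => /andP[la ta] bh.
have le_ab := coverW cab.
have [|cd td] := @transpose_down a b h cab.
  rewrite (meetC b) modL //; apply/meet_r.
  by apply: le_trans bh _; rewrite joinC leU2.
apply/(invP cd td); apply: H => //; last exact: leIr.
by rewrite lexI la.
Qed.

Definition collapsed x y := all_covers (x `&` y) (x `|` y).

Lemma collapsedC x y : collapsed x y -> collapsed y x.
Proof. by rewrite /collapsed meetC joinC. Qed.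

Lemma meet_le_join x y : x `&` y <= x `|` y.
Proof. exact: le_trans (leIl _ _) (leUl _ _). Qed.

Lemma collapsed_meet x y t : collapsed x y -> collapsed (x `&` t) (y `&` t).
Proof.
move=> /(@all_covers_meet _ _ t (meet_le_join x y)); apply: all_covers_sub.
  by rewrite lexI !leI2 ?leIl ?leIr.
by rewrite leUx !leI2 ?leUl ?leUr.
Qed.

Lemma collapsed_join x y t : collapsed x y -> collapsed (x `|` t) (y `|` t).
Proof.
move=> /(@all_covers_join _ _ t (meet_le_join x y)); apply: all_covers_sub.
  by rewrite lexI !leU2 ?leIl ?leIr.
by rewrite leUx !leU2 ?leUl ?leUr.
Qed.

Lemma collapsed_trans x y z : collapsed x y -> collapsed y z -> collapsed x z.
Proof.
move=> xy yz.
have H1 : all_covers ((x `&` y) `&` z) (y `&` z).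
  apply: all_covers_sub (@all_covers_meet _ _ z (meet_le_join x y) xy) => //.
  by rewrite leI2 ?leUr.
have H2 : all_covers (y `|` z) (x `|` y `|` z).
  apply: all_covers_sub (@all_covers_join _ _ z (meet_le_join x y) xy) => //.
  by rewrite leU2 ?leIr.
have H : all_covers (x `&` y `&` z) (x `|` y `|` z).
  apply: all_covers_cat H2; last 1 first.
  - by apply: all_covers_cat H1 yz; rewrite ?meet_le_join // leI2 ?leIr.
  - apply: le_trans (meet_le_join y z); by rewrite leI2 ?leIr.
  - by rewrite leU2 ?leUr.
apply: all_covers_sub H.
  by rewrite leI2 ?leIl.
by rewrite leU2 ?leUl.
Qed.

Lemma collapsed_congruence : lattice_congruence (fun x y => `[< collapsed x y >]).
Proof.
split=> [x y z|x x' y y' /asboolP xx' /asboolP yy'].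
  split=> [|/asboolP xy].
    apply/asboolP => a b [ab _]; rewrite meetxx joinxx => xa bx.
    by move: (lt_le_trans ab (le_trans bx xa)); rewrite ltxx.
  by apply/asboolP/asboolP; apply: collapsed_trans => //; apply: collapsedC.
split; apply/asboolP.
  apply: (collapsed_trans (@collapsed_meet _ _ y xx')).
  by rewrite ![x' `&` _]meetC; apply: collapsed_meet.
apply: (collapsed_trans (@collapsed_join _ _ y xx')).
by rewrite ![x' `|` _]joinC; apply: collapsed_join.
Qed.

(** The congruence that collapses the covers satisfying P is not the equality,
    hence total. *)
Lemma simple_projectively_invariant a b :
  simple_lattice L -> covers a b -> P a b -> forall c d, covers c d -> P c d.
Proof.
move=> simpleL cab Pab c d ccd.
have [eqr|tot] := simpleL _ collapsed_congruence.
  have: `[< collapsed a b >].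
    apply/asboolP => c' d' [cd' _]; rewrite meet_l ?join_r ?(coverW cab) // => ac' db'.
    have [ab alt] := cab.
    have [||Ec|Ec] := alt c'; [by []|exact: le_trans (ltW cd') db'| |].
      have [||Ed|Ed] := alt d'; [exact: le_trans ac' (ltW cd')|by []| |].
        by rewrite Ec Ed ltxx in cd'.
      by rewrite Ec Ed.
    by rewrite -Ec in db'; move: (lt_le_trans cd' db'); rewrite ltxx.
  by rewrite eqr => /eqP E; case: cab => ab _; move: ab; rewrite E ltxx.
by have /asboolP := tot \bot \top; apply=> //; rewrite ?meet0x ?joinx1.
Qed.

End ProjectiveInvariant.
End Modular.
End Covers.

(** * Congruence preserving maps and the Mal'cev operation *)

Notation "x ~[ a ] y" := ((x, y) \in cong_set a)
  (at level 70, a at level 200, format "x  ~[ a ]  y").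

Section Congruences.
Variable A : finAlgebra.
Implicit Types a b c : congruence A.

Lemma cong_refl a x : x ~[a] x.
Proof. by have [/(_ x x x)[]] := congruenceP a. Qed.

Lemma cong_trans a y x z : x ~[a] y -> y ~[a] z -> x ~[a] z.
Proof. by move=> xy yz; have [/(_ x y z)[_ /(_ xy)->]] := congruenceP a. Qed.

Lemma cong_sym a x y : x ~[a] y -> y ~[a] x.
Proof.
by move=> xy; have [/(_ x y x)[_ /(_ xy)<-]] := congruenceP a; rewrite cong_refl.
Qed.

Lemma cong_le_mem a b x y : (a <= b)%O -> x ~[a] y -> x ~[b] y.
Proof. by move/subsetP; apply. Qed.

Lemma mem_meet a b x y : (x ~[(a `&` b)%O] y) = (x ~[a] y) && (x ~[b] y).
Proof. by rewrite cong_meetE inE. Qed.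

Lemma mem_bot (x y : A) : (x ~[\bot%O] y) = (x == y).
Proof. by rewrite cong_botE inE. Qed.

Lemma mem_top (x y : A) : x ~[\top%O] y.
Proof. by rewrite cong_topE inE. Qed.

(** The choice depends only on the class, so rep a turns equivalence modulo a
    into equality. *)
Definition rep a (x : A) := odflt x [pick z | x ~[a] z].

Lemma rep_cong a x : x ~[a] rep a x.
Proof. by rewrite /rep; case: pickP => // _; apply: cong_refl. Qed.

Lemma rep_eq a x y : x ~[a] y -> rep a x = rep a y.
Proof.
move=> xy; rewrite /rep (@eq_pick _ _ (fun z => y ~[a] z)) => [|z].
  by case: pickP => // /(_ y); rewrite cong_refl.
by apply/idP/idP; apply: cong_trans => //; apply: cong_sym.
Qed.

Definition compatible (I : Type) (f : (I -> A) -> A) :=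
  forall a (x y : I -> A), (forall i, x i ~[a] y i) -> f x ~[a] f y.

(** One argument is singled out, to be moved while the others are kept. *)
Definition compatible2 (I : Type) (f : (I -> A) -> A -> A) :=
  forall a (x y : I -> A) t u,
    (forall i, x i ~[a] y i) -> t ~[a] u -> f x t ~[a] f y u.

Definition malcev_op (m : A -> A -> A -> A) :=
  (forall x y : A, m x x y = y /\ m y x x = y) /\
  (forall a (x x' y y' z z' : A), x ~[a] x' -> y ~[a] y' -> z ~[a] z' ->
     m x y z ~[a] m x' y' z').

Lemma eval_compatible n (t : term A n) a (x y : n.-tuple A) :
  (forall i, tnth x i ~[a] tnth y i) -> eval x t ~[a] eval y t.
Proof.
move=> xy; elim: t => [i|s args IH] /=; first exact: xy.
have [_ pres] := congruenceP a; apply: pres => i.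
by rewrite !tnth_mktuple.
Qed.

Lemma exists_malcev_op : has_malcev_term A -> exists m, malcev_op m.
Proof.
move=> [t mt]; exists (fun x y z => eval [tuple x; y; z] t); split=> [//|].
move=> a x x' y y' z z' xx yy zz; apply: eval_compatible.
by case; case=> [|[|[|]]] //= lti; rewrite !(tnth_nth x).
Qed.

Section Malcev.
Variable m : A -> A -> A -> A.
Hypothesis mP : malcev_op m.

Lemma malcevl x y : m x x y = y. Proof. by have [] := mP.1 x y. Qed.
Lemma malcevr x y : m y x x = y. Proof. by have [] := mP.1 x y. Qed.

Lemma malcev_compatible a x x' y y' z z' :
  x ~[a] x' -> y ~[a] y' -> z ~[a] z' -> m x y z ~[a] m x' y' z'.
Proof. exact: mP.2. Qed.

(** The fourth vertex of the parallelogram x, y, z is m x y z. *)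
Lemma permute a b x y z :
  x ~[b] y -> y ~[a] z -> exists2 w, x ~[a] w & w ~[b] z.
Proof.
move=> xy yz; exists (m x y z).
  rewrite -[X in X ~[_] _](malcevr y).
  by apply: malcev_compatible; rewrite ?cong_refl.
rewrite -[X in _ ~[_] X](malcevl y).
by apply: malcev_compatible; rewrite ?cong_refl.
Qed.

Let comp_set a b : {set A * A} :=
  [set p | [exists w, (p.1 ~[a] w) && (w ~[b] p.2)]].

Let comp_setP a b x y :
  reflect (exists2 w, x ~[a] w & w ~[b] y) ((x, y) \in comp_set a b).
Proof.
rewrite inE; apply: (iffP existsP) => [[w /andP[]]|[w h1 h2]]; exists w => //.
by rewrite h1.
Qed.

Let comp_set_trans a b x y z : (x, y) \in comp_set a b ->
  (y, z) \in comp_set a b -> (x, z) \in comp_set a b.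
Proof.
move=> /comp_setP[w xw wy] /comp_setP[w' yw wz].
have [u wu uw] := permute wy yw.
by apply/comp_setP; exists u; [apply: cong_trans wu | apply: cong_trans wz].
Qed.

Let comp_set_cong a b : is_congruence (comp_set a b).
Proof.
split=> [x y z|s x y xy].
  split=> [|xy]; first by apply/comp_setP; exists z; exact: cong_refl.
  apply/idP/idP; apply: comp_set_trans => //.
  have /comp_setP[w xw wy] := xy.
  have [u yu ux] := permute (cong_sym wy) (cong_sym xw).
  by apply/comp_setP; exists u.
have w i : {w | (tnth x i ~[a] w) && (w ~[b] tnth y i)}.
  by apply: sigW; have /comp_setP[w xw wy] := xy i; exists w; rewrite xw.
apply/comp_setP; exists (basic s [tuple sval (w i) | i < arity s]).
  have [_ pres] := congruenceP a; apply: pres => i.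
  by rewrite tnth_mktuple; case: (w i) => /= v /andP[].
have [_ pres] := congruenceP b; apply: pres => i.
by rewrite tnth_mktuple; case: (w i) => /= v /andP[].
Qed.

(** Since congruences permute, the relational product is already transitive
    and symmetric. *)
Lemma mem_join a b x y :
  x ~[(a `|` b)%O] y <-> exists2 w, x ~[a] w & w ~[b] y.
Proof.
split=> [|[w xw wy]]; last first.
  apply: (@cong_trans _ w).
    by apply: cong_le_mem xw; rewrite leUl.
  by apply: cong_le_mem wy; rewrite leUr.
pose j := Congruence (asboolT (comp_set_cong a b)).
have le_j : (a `|` b <= j)%O.
  rewrite leUx !cong_leE; apply/andP; split; apply/subsetP => -[u v] uv.
    by apply/comp_setP; exists v; rewrite ?cong_refl.
  by apply/comp_setP; exists u; rewrite ?cong_refl.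
by move=> /(cong_le_mem le_j)/comp_setP.
Qed.

Lemma congruences_modular : @modular_lattice _ (congruence A).
Proof.
move=> a b c ac; apply/le_anti/andP; split.
  by rewrite lexI !leUx ac leIr leUl leIxl // leUr.
rewrite cong_leE; apply/subsetP => -[x y].
rewrite mem_meet => /andP[/mem_join[w xw wy] xy].
apply/mem_join; exists w => //; rewrite mem_meet wy.
exact: cong_trans (cong_sym (cong_le_mem ac xw)) xy.
Qed.

(** ** Centrality *)

(** The term condition for the algebra with all congruence preserving functions
    as operations: c centralizes b modulo a. *)
Definition central c a b := forall I (f : (I -> A) -> A -> A),
  compatible2 f -> forall (x y : I -> A) t u, (forall i, x i ~[c] y i) -> t ~[b] u ->
  f x t ~[a] f x u -> f y t ~[a] f y u.

Lemma central_join c d a b :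
  central c a b -> central d a b -> central (c `|` d)%O a b.
Proof.
move=> cc cd I f cf x y t u xy tu fx.
have /choice[w wP] i : exists w, x i ~[c] w /\ w ~[d] y i.
  by have /mem_join[w] := xy i; exists w.
apply: (cd I f cf w) => // [i|]; first by have [] := wP i.
by apply: (cc I f cf x) => // i; have [] := wP i.
Qed.

(** Upwards, u is replaced by a point related to t modulo b and to u modulo a';
    downwards, the values of f are related modulo b anyway, and a is the meet of
    a' and b. *)
Lemma central_transposed c a b a' b' :
  transposed a b a' b' -> central c a b <-> central c a' b'.
Proof.
move=> [<- <-]; split=> cen I f cf x y t u xy tu fx; last first.
  have ftu z : f z t ~[b] f z u by apply: cf => // i; apply: cong_refl.
  rewrite mem_meet ftu; apply: (cen I f cf x) => //.
    by apply: cong_le_mem tu; rewrite leUl.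
  by apply: cong_le_mem fx; rewrite leIr.
have /mem_join[w tw wu] := tu.
have fwu z : f z w ~[a'] f z u by apply: cf => // i; apply: cong_refl.
apply: cong_trans (fwu y).
apply: (@cong_le_mem (b `&` a')%O); first by rewrite leIr.
apply: (cen I f cf x) => //; rewrite mem_meet; apply/andP; split.
  by apply: cf => // i; apply: cong_refl.
exact: cong_trans fx (cong_sym (fwu x)).
Qed.

(** The element m (f y t) (f x t) (f x u) is related to f y u both modulo c
    and modulo b, hence modulo a. *)
Lemma central_meet c a b : (c `&` b <= a)%O -> central c a b.
Proof.
move=> le_a I f cf x y t u xy tu fx.
have fyx v : f y v ~[c] f x v.
  by apply: cf => [i|]; [apply: cong_sym | apply: cong_refl].
have fb z : f z t ~[b] f z u by apply: cf => // i; apply: cong_refl.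
pose p := m (f y t) (f x t) (f x u).
apply: (@cong_trans _ p).
  rewrite -[X in X ~[_] _](malcevr (f x t)).
  by apply: malcev_compatible; rewrite ?cong_refl.
apply: (cong_le_mem le_a); rewrite mem_meet; apply/andP; split.
  apply: (@cong_trans _ (f x u)); last exact/cong_sym.
  rewrite -[X in _ ~[_] X](malcevl (f x t)).
  by apply: malcev_compatible; rewrite ?cong_refl.
apply: cong_trans (fb y).
rewrite -[X in _ ~[_] X](malcevr (f x t)).
by apply: malcev_compatible; rewrite ?cong_refl //; apply: cong_sym.
Qed.

Hypothesis simpleL : simple_lattice (congruence A).
Hypothesis card_gt2 : 2 < #|{: congruence A}|.

(** Otherwise the proper elements form a prime ideal, and the congruence that
    separates it from the greatest element leaves just two classes. *)
Lemma join_top :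
  exists c d : congruence A, [/\ c != \top, d != \top & c `|` d = \top]%O.
Proof.
apply: contrapT => none.
have joinT (c d : congruence A) :
    ((c `|` d)%O == \top%O) = (c == \top%O) || (d == \top%O).
  apply/idP/orP => [/eqP E|[]/eqP->]; rewrite ?joinx1 ?join1x //.
  have [_|nc] := eqVneq c \top%O; first by left.
  have [_|nd] := eqVneq d \top%O; first by right.
  by case: none; exists c, d.
have [] := simpleL (r := fun c d => (c == \top%O) == (d == \top%O)).
- split=> [x y z|x x' y y' /eqP xx /eqP yy].
    by split=> //= /eqP ->.
  by rewrite /= !joinT !meet_eq1 xx yy.
- move=> E; have inj : injective (fun c : congruence A => c == \top%O).
    by move=> c d cd; apply/eqP; rewrite -E; apply/eqP.
  by have := leq_card _ inj; rewrite card_bool leqNgt card_gt2.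
- move=> /(_ \bot%O \top%O); rewrite eqxx => /eqP/eqP E.
  have inj : injective (fun c : congruence A => tt).
    by move=> c d _; apply/le_anti/andP; split;
      apply: le_trans (lex1 _) _; rewrite -E le0x.
  by have := leq_card _ inj; rewrite card_unit leqNgt (ltnW card_gt2).
Qed.

(** A proper congruence c lies below a coatom x and centralizes the cover of x
    by the top, as the meet condition holds there; by projectivity it centralizes
    all covers. The top is a join of two proper congruences. *)
Lemma simple_central a b : covers a b -> central \top%O a b.
Proof.
have [c [d [nc nd <-]]] := join_top.
suff cenP e : e != \top%O -> forall a b, covers a b -> central e a b.
  by move=> cab; apply: central_join; apply: cenP.
rewrite -ltx1 => /cover_below[x cx ex].
apply: (@simple_projectively_invariant _ _ congruences_modular (central e) _
  x \top%O) => //.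
  by move=> a1 b1 c1 d1 _; apply: central_transposed.
by apply: central_meet; rewrite meetx1.
Qed.

End Malcev.
End Congruences.

(** * Absorbing functions and splitting *)

Definition update (I : eqType) (T : Type) (f : I -> T) i v :=
  fun j => if j == i then v else f j.

Section Absorbing.
Variables (A : finAlgebra) (m : A -> A -> A -> A).
Hypothesis mP : malcev_op m.
Implicit Types a b c : congruence A.

(** In the language of higher commutators, the commutator of the t_i does not
    vanish. The base points o_i may differ from place to place, because the
    decomposition of a join moves one of them. *)
Definition absorbing (I : finType) (t : I -> congruence A) :=
  exists (d : (I -> A) -> A) (o p : I -> A) (e : A),
    [/\ compatible d, forall i, o i ~[t i] p i,
        forall x i, x i = o i -> d x = e & d p != e].

Lemma absorbing_mem (I : finType) (t : I -> congruence A) :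
  absorbing t -> exists u v, u != v /\ forall i, u ~[t i] v.
Proof.
move=> [d [o [p [e [cd op de dp]]]]]; exists (d p), e; split=> // i.
have <- : d (update p i (o i)) = e by apply: (de _ i); rewrite /update eqxx.
apply: cd => j; rewrite /update; case: eqP => [->|_].
  exact: cong_sym.
exact: cong_refl.
Qed.

(** If p and o are joined at i through w, then either d is still nontrivial
    when p is moved to w, or subtracting d at w makes d absorb w as well. *)
Lemma absorbing_join (I : finType) (t : I -> congruence A) i b c :
  t i = (b `|` c)%O -> absorbing t ->
  absorbing (update t i b) \/ absorbing (update t i c).
Proof.
move=> ti [d [o [p [e [cd op de dp]]]]].
have := op i; rewrite ti => /(mem_join mP)[w ow wp].
have [dw|dw] := eqVneq (d (update p i w)) e; last first.
  left; exists d, o, (update p i w), e; split=> // j.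
  by rewrite /update; case: eqP => [->|_].
right; exists (fun x => m (d x) (d (update x i w)) e), (update o i w), p, e.
split=> [f x y xy|j|x j|].
- apply: (malcev_compatible mP); [| |exact: cong_refl].
    exact: cd.
  by apply: cd => j; rewrite /update; case: eqP => // _; apply: cong_refl.
- by rewrite /update; case: eqP => [->|_].
- rewrite {1}/update; case: eqP => [->|nji] xj.
    suff -> : update x i w = x by rewrite (malcevl mP).
    by apply/funext => l; rewrite /update; case: eqP => // ->.
  by rewrite (de x j) // (de _ j) ?(malcevl mP) // /update; case: eqP.
- by rewrite dw (malcevr mP).
Qed.

Lemma absorbing_join_seq (I : finType) (t : I -> congruence A) b c (J : seq I) :
  uniq J -> (forall i, i \in J -> t i = b `|` c)%O -> absorbing t ->
  exists s, [/\ absorbing s, forall i, i \notin J -> s i = t i &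
                forall i, i \in J -> (s i == b) || (s i == c)].
Proof.
elim: J t => [|j J IH] t /=; first by move=> _ _ abt; exists t.
move=> /andP[jJ uJ] tJ abt.
have tj : t j = (b `|` c)%O by apply: tJ; rewrite mem_head.
suff [v [abv vbc]] : exists v, absorbing (update t j v) /\ ((v == b) || (v == c)).
  have [|s [abs sn sJ]] := IH (update t j v) uJ _ abv.
    move=> i iJ; rewrite /update; case: eqP => [E|_]; first by rewrite -E iJ in jJ.
    by apply: tJ; rewrite inE iJ orbT.
  exists s; split=> // i; rewrite inE.
    by rewrite negb_or => /andP[nij niJ]; rewrite sn // /update (negbTE nij).
  by have [->|_] := eqVneq i j; [rewrite sn // /update eqxx | apply: sJ].
have [abv|abv] := absorbing_join tj abt; [exists b|exists c]; split=> //;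
  by rewrite eqxx ?orbT.
Qed.

(** Only lower bounds on multiplicities are required, and the type may contain
    further congruences, so that a batch of occurrences can be replaced without
    leaving the notion. In terms of higher commutators: those in which all members
    of X occur arbitrarily often do not all vanish. *)
Definition nonvanishing (X : {set congruence A}) := forall k,
  exists (I : finType) (t : I -> congruence A), absorbing t /\
    forall x, x \in X -> k <= #|[set i | t i == x]|.

Lemma subset_card (T : finType) (X : {set T}) n :
  n <= #|X| -> exists2 Y : {set T}, Y \subset X & #|Y| = n.
Proof.
move=> le_n; exists [set x in take n (enum X)].
  by apply/subsetP => x; rewrite inE => /mem_take; rewrite mem_enum.
by rewrite cardsE (card_uniqP (take_uniq _ (enum_uniq _))) size_takel // -cardE.
Qed.

(** Replace a batch of 2 k occurrences of the join by b or c, leaving k others;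
    one of b and c then occurs at least k times. *)
Lemma nonvanishing_join (X : {set congruence A}) b c :
  nonvanishing X -> (b `|` c)%O \in X ->
  nonvanishing (b |: X) \/ nonvanishing (c |: X).
Proof.
move=> gX bcX; apply: contrapT => /not_orP[/existsNP[k1 nb] /existsNP[k2 nc]].
pose k := maxn k1 k2; have [I [t [abt tX]]] := gX (k + (k + k)).
have [J /subsetP Jx cardJ] : exists2 J : {set I},
    J \subset [set i | t i == (b `|` c)%O] & #|J| = k + k.
  by apply: subset_card; apply: leq_trans (tX _ bcX); rewrite leq_addl.
have [i|s [abs sn sJ]] := @absorbing_join_seq I t b c (enum J) (enum_uniq _) _ abt.
  by rewrite mem_enum => /Jx; rewrite inE => /eqP.
have le_k z : z \in X -> k <= #|[set i | s i == z]|.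
  move=> zX; have := tX z zX; rewrite -(cardsID J) => le_k.
  have le_J : #|[set i | t i == z] :&: J| <= k + k.
    by rewrite -cardJ; apply/subset_leq_card/subsetIr.
  apply: (@leq_trans #|[set i | t i == z] :\: J|).
    rewrite -(leq_add2l (k + k)) addnC; apply: leq_trans le_k _.
    by rewrite leq_add2r.
  apply/subset_leq_card/subsetP => i; rewrite !inE => /andP[niJ].
  by rewrite sn // mem_enum.
have le2 : k + k <= #|[set i | s i == b]| + #|[set i | s i == c]|.
  rewrite -cardJ; apply: leq_trans (leq_card_setU _ _).
  apply/subset_leq_card/subsetP => i iJ; rewrite !inE.
  by apply: sJ; rewrite mem_enum.
have [le_b|lt_b] := leqP k #|[set i | s i == b]|.
  apply: nb; exists I, s; split=> // z /setU1P[->|/le_k le_z];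
    [apply: leq_trans le_b | apply: leq_trans le_z]; exact: leq_maxl.
have [le_c|lt_c] := leqP k #|[set i | s i == c]|.
  apply: nc; exists I, s; split=> // z /setU1P[->|/le_k le_z];
    [apply: leq_trans le_c | apply: leq_trans le_z]; exact: leq_maxr.
by move: le2; rewrite leqNgt -addSn leq_add // ltnW.
Qed.

(** The complement of a maximal nonvanishing set X is closed under joins; the
    members of X have a nonzero meet because an absorbing function takes its values
    modulo all congruences of its type. *)
Lemma nonvanishing_splits : nonvanishing [set \top%O] -> splits (congruence A).
Proof.
move=> gT.
have [X maxX TX] := @maxset_exists _ (fun X => `[< nonvanishing X >]) _
  (introT (asboolP _) gT).
have [/asboolP gX max] := maxsetP maxX.
have {}max x : nonvanishing (x |: X) -> x \in X.
  by move=> gxX; rewrite -(max (x |: X)) ?setU11 ?subsetU1 //; apply/asboolP.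
have {}TX : \top%O \in X by rewrite -sub1set.
have [I [t [/absorbing_mem[u [v [nuv tuv]]] tX]]] := gX 1.
have uvX x : x \in X -> u ~[x] v.
  by move=> /tX /card_gt0P[i]; rewrite inE => /eqP <-.
pose delta := (\join_(x | x \notin X) x)%O.
have ndelta : delta \notin X.
  rewrite /delta; elim/big_ind: _ => // [|x y nx ny].
    by apply: contra nuv => /uvX; rewrite mem_bot.
  apply/negP => /(nonvanishing_join gX)[] /max; first by rewrite (negbTE nx).
  by rewrite (negbTE ny).
exists delta, (\meet_(x in X) x)%O; split.
- by rewrite ltx1; apply: contraNneq ndelta => ->.
- rewrite lt0x; apply: contra nuv => /eqP E; rewrite -mem_bot -E.
  elim/big_ind: _ => [|x y ux uy|x /uvX //]; first exact: mem_top.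
  by rewrite mem_meet ux.
- move=> a; have [aX|naX] := boolP (a \in X).
    by right; apply: (@meets_inf _ _ _ a (fun x => x \in X) id).
  by left; apply: (@joins_sup _ _ _ a (fun x => x \notin X) id).
Qed.

Lemma absorbing_bounded : ~ splits (congruence A) ->
  exists K, forall I : finType, absorbing (fun _ : I => \top%O) -> #|I| < K.
Proof.
move=> nsp; have /existsNP[k nk] : ~ nonvanishing [set \top%O].
  by move/nonvanishing_splits.
exists k => I abI; rewrite ltnNge; apply/negP => le_k; apply: nk.
exists I, (fun=> \top%O); split=> // x /set1P->.
by apply: leq_trans le_k _; apply/subset_leq_card/subsetP => i; rewrite !inE eqxx.
Qed.

End Absorbing.

(** * Finite generation *)

Section Generation.
Variable A : finAlgebra.
Implicit Types a b c : congruence A.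

Lemma Comp_list N : exists s : seq {k : nat & operation A k},
  forall k (f : operation A k), Tagged (operation A) f \in s <-> Comp A _ f /\ k < N.
Proof.
exists (flatten [seq [seq Tagged (operation A) f |
    f <- enum {: operation A j} & `[< Comp A _ f >]] | j <- iota 0 N]) => k f.
split.
  move=> /flatten_mapP[j]; rewrite mem_iota => /andP[_ ltj] /mapP[g].
  rewrite mem_filter => /andP[/asboolP cg _] E.
  pose P (p : {k : nat & operation A k}) := Comp A _ (tagged p) /\ tag p < N.
  by rewrite -/(P (Tagged (operation A) f)) E.
move=> [cf ltk]; apply/flatten_mapP; exists k; first by rewrite mem_iota.
by apply: map_f; rewrite mem_filter mem_enum andbT; apply/asboolP.
Qed.

Lemma composition_eq (F : opset A) k n (h : operation A k) (f : operation A n)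
    (g : 'I_n -> operation A k) :
  F n f -> (forall i, composition_of F (g i)) ->
  (forall x, h x = f [tuple g i x | i < n]) -> composition_of F h.
Proof.
move=> Ff Fg E.
have -> : h = [ffun x : k.-tuple A => f [tuple g i x | i < n]].
  by apply/ffunP => x; rewrite ffunE.
exact: Composition.
Qed.

Lemma composition_binary (F : opset A) k (q : A -> A -> A)
    (h1 h2 : operation A k) :
  F 2 [ffun x : 2.-tuple A => q (tnth x 0%R) (tnth x 1%R)] ->
  composition_of F h1 -> composition_of F h2 ->
  composition_of F [ffun x => q (h1 x) (h2 x)].
Proof.
move=> Fq Fh1 Fh2.
apply: (composition_eq (g := tnth [tuple h1; h2]) Fq) => [i|x].
  by case: i; case=> [|[|[]]] //= lti; rewrite (tnth_nth h1).
by rewrite !ffunE !tnth_mktuple !(tnth_nth h1).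
Qed.

(** ** Lattices with at most two elements *)

(** Every function is the sum of its restrictions to single points, where the
    sum of x and y is y if x is the neutral element o, and x otherwise. *)
Lemma binary_functions_generate (F : opset A) k (f : operation A k) :
  (forall g : operation A 2, F 2 g) -> 0 < k -> composition_of F f.
Proof.
move=> F2; case: k f => // k f _.
have [o _] : exists o : A, o \in A by apply/card_gt0P/carrier_gt0.
have Fproj (q : A -> A -> A) (h1 h2 : operation A k.+1) :
    composition_of F h1 -> composition_of F h2 ->
    composition_of F [ffun x => q (h1 x) (h2 x)].
  exact/composition_binary/F2.
have Fconst u : composition_of F [ffun _ : k.+1.-tuple A => u].
  have := Fproj (fun _ _ => u) _ _ (Projection F 0%R) (Projection F 0%R).
  by congr composition_of; apply/ffunP => x; rewrite !ffunE.
have point (b : k.+1.-tuple A) (r : seq 'I_k.+1) : composition_of F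
    [ffun x => if all (fun i => tnth x i == tnth b i) r then f b else o].
  elim: r => [|i r IH]; first exact: Fconst.
  have := Fproj (fun y z => if y == tnth b i then z else o) _ _ (Projection F i) IH.
  congr composition_of; apply/ffunP => x; rewrite !ffunE /=.
  by case: eqP.
have cases (r : seq (k.+1.-tuple A)) :
    composition_of F [ffun x => if x \in r then f x else o].
  elim: r => [|b r IH].
    by have := Fconst o; congr composition_of; apply/ffunP => x; rewrite !ffunE.
  have := Fproj (fun y z => if y == o then z else y) _ _ (point b (enum 'I_k.+1)) IH.
  congr composition_of; apply/ffunP => x; rewrite !ffunE inE.
  have -> : all (fun i => tnth x i == tnth b i) (enum 'I_k.+1) = (x == b).
    apply/allP/eqP => [xb|-> //].
    by apply: eq_from_tnth => i; apply/eqP/xb; rewrite mem_enum.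
  have [->|_] /= := eqVneq x b; last by rewrite eqxx.
  by case: eqP => [->|//]; case: ifP.
have := cases (enum {: k.+1.-tuple A}).
by congr composition_of; apply/ffunP => x; rewrite ffunE mem_enum.
Qed.

Lemma small_lattice_preserves : #|{: congruence A}| <= 2 ->
  forall k (f : operation A k) a, preserves f a.
Proof.
move=> le2 k f a x y xy.
have [aT|naT] := eqVneq a \top%O; first by rewrite aT; apply: mem_top.
have [a0|na0] := eqVneq a \bot%O.
  move: xy; rewrite a0 => xy; have -> : x = y; last exact: cong_refl.
  by apply: eq_from_tnth => i; apply/eqP; rewrite -mem_bot.
have [E|n01] := eqVneq (\bot%O : congruence A) \top%O.
  by case/eqP: naT; apply/le_anti; rewrite lex1 -E le0x.
suff : 2 < #|{: congruence A}| by rewrite ltnNge le2.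
have /card_uniqP E : uniq [:: a; \bot%O; \top%O].
  by rewrite /= !inE negb_or na0 naT n01.
by apply: leq_trans (max_card [in [:: a; \bot%O; \top%O]]); rewrite E.
Qed.

Lemma small_lattice_finitely_generated :
  #|{: congruence A}| <= 2 -> finitely_generated (Comp A).
Proof.
move=> le2; have [s sP] := Comp_list 3; exists s; split=> k f.
  by move=> /sP[].
move=> [k0 _]; apply: binary_functions_generate => // g; apply/sP; split=> //.
by split=> // a; apply: small_lattice_preserves.
Qed.

(** ** Functions determined by their values on tuples of small support *)

Variable m : A -> A -> A -> A.
Hypothesis mP : malcev_op m.
Variable o : A.

Definition restrict k (S : {set 'I_k}) (x : k.-tuple A) :=
  [tuple if i \in S then tnth x i else o | i < k].

Lemma restrictI k (S T : {set 'I_k}) x :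
  restrict S (restrict T x) = restrict (S :&: T) x.
Proof.
apply: eq_from_tnth => i; rewrite !tnth_mktuple inE.
by case: (i \in S).
Qed.

Variable K : nat.
Hypothesis absK : forall I : finType,
  absorbing (fun _ : I => \top%O : congruence A) -> #|I| < K.

(** On a minimal support where f and g differ, their difference is absorbing. *)
Lemma eq_small_support k (f g : operation A k) : Comp A _ f -> Comp A _ g ->
  (forall S : {set 'I_k}, #|S| < K -> forall x,
     f (restrict S x) = g (restrict S x)) -> f = g.
Proof.
move=> [_ cf] [_ cg] fg; apply/ffunP => x0; apply/eqP/contraT => nfg.
pose P (S : {set 'I_k}) := [exists x, f (restrict S x) != g (restrict S x)].
have restrictT x : restrict [set: 'I_k] x = x.
  by apply: eq_from_tnth => i; rewrite tnth_mktuple inE.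
have PT : P [set: 'I_k] by apply/existsP; exists x0; rewrite !restrictT.
have [T /minsetP[/existsP[x nfgx] minT] _] := minset_exists PT.
have subT (S : {set 'I_k}) y : S \proper T -> f (restrict S y) = g (restrict S y).
  move=> /properP[ST [i iT niS]]; apply/eqP/contraT => nfgy.
  by rewrite (minT S) ?iT // in niS; apply/existsP; exists y.
pose I : finType := {i : 'I_k | i \in T}.
suff /absK : absorbing (fun _ : I => \top%O : congruence A).
  rewrite card_sig => ltK; have := fg T _ x; rewrite (eq_card (B := [in T])) in ltK => //.
  by move=> /(_ ltK) E; rewrite E eqxx in nfgx.
pose ext (y : I -> A) : k.-tuple A :=
  [tuple if insub i is Some j then y j else o | i < k].
have ext_cong a (y z : I -> A) : (forall i, y i ~[a] z i) ->
    forall i, tnth (ext y) i ~[a] tnth (ext z) i.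
  by move=> yz i; rewrite !tnth_mktuple; case: insub => // *; apply: cong_refl.
pose e := g (restrict T x).
exists (fun y => m (f (ext y)) (g (ext y)) e), (fun=> o),
  (fun j => tnth x (val j)), e; split=> [a y z yz|i|y j yj|].
- apply: (malcev_compatible mP); [apply: cf|apply: cg|exact: cong_refl];
    exact: ext_cong.
- exact: mem_top.
- suff E : ext y = restrict (T :\ val j) (ext y).
    by rewrite E subT ?(malcevl mP) // properD1 // (valP j).
  apply: eq_from_tnth => i; rewrite !tnth_mktuple !inE.
  case: insubP => [l lT li|niT]; last by rewrite (negbTE niT) andbF.
  rewrite lT andbT; have [E|//] := eqVneq i (val j).
  by rewrite -yj; congr y; apply: val_inj; rewrite li.
- have -> : ext (fun j => tnth x (val j)) = restrict T x.
    apply: eq_from_tnth => i; rewrite !tnth_mktuple.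
    by case: insubP => [l lT li|/negbTE->//]; rewrite lT li.
  by rewrite (malcevr mP).
Qed.

Section Span.
Variables (F : opset A) (k : nat).
Hypothesis Fm : F [ffun x : 3.-tuple A => m (tnth x 0%R) (tnth x 1%R) (tnth x 2%:R%R)].
Hypothesis FK : forall f : operation A K.+1, Comp A _ f -> F f.

Lemma composition_malcev (h1 h2 h3 : operation A k) :
  composition_of F h1 -> composition_of F h2 -> composition_of F h3 ->
  composition_of F [ffun x => m (h1 x) (h2 x) (h3 x)].
Proof.
move=> Fh1 Fh2 Fh3.
apply: (composition_eq (g := tnth [tuple h1; h2; h3]) Fm) => [i|x].
  by case: i; case=> [|[|[|[]]]] //= lti; rewrite (tnth_nth h1).
by rewrite !ffunE !tnth_mktuple !(tnth_nth h1).
Qed.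

(** The restricted function depends on fewer than K arguments, so it is a
    generator applied to projections; unused places of the generator are filled
    with the default of nth. *)
Lemma composition_restrict (g : operation A k) (S : {set 'I_k}) :
  Comp A _ g -> #|S| < K -> composition_of F [ffun x => g (restrict S x)].
Proof.
move=> [k_gt0 cg] ltK; have i0 : 'I_k by case: k k_gt0 => // n _; exact: ord0.
pose place (y : K.+1.-tuple A) : k.-tuple A :=
  [tuple if i \in S then tnth y (inord (index i (enum S))) else o | i < k].
apply: (composition_eq (f := [ffun y => g (place y)])
  (g := fun j => [ffun x => tnth x (nth i0 (enum S) j)])).
- apply: FK; split=> // a x y xy; rewrite !ffunE; apply: cg => i.
  by rewrite !tnth_mktuple; case: ifP => // _; apply: cong_refl.
- by move=> i; apply: Projection.
move=> x; rewrite !ffunE; congr (g _); apply: eq_from_tnth => i.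
rewrite !tnth_mktuple; case: ifP => // iS.
rewrite ffunE inordK ?nth_index ?mem_enum //.
by rewrite ltnS ltnW // (leq_ltn_trans _ ltK) // cardE ltnW // index_mem mem_enum.
Qed.

Lemma composition_of_Comp (f : operation A k) :
  (forall n (g : operation A n), F g -> Comp A _ g) -> 0 < k ->
  composition_of F f -> Comp A _ f.
Proof.
move=> FC k_gt0 cf; split=> // a; elim: cf => [i|n g h Fg _ IH] x y xy.
  by rewrite !ffunE.
rewrite !ffunE; apply: (FC _ _ Fg).2 => i.
by rewrite !tnth_mktuple; apply: IH.
Qed.

(** Correct h on one more support S at a time, the smaller ones first: adding
    the difference of f and h at the restriction of the argument to S does not
    disturb the supports treated before. *)
Lemma interpolate_small_supports (f : operation A k)
    (D : {set {set 'I_k}}) :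
  (forall n (g : operation A n), F g -> Comp A _ g) -> Comp A _ f ->
  (forall S, S \in D -> #|S| < K) ->
  (forall S T : {set 'I_k}, T \subset S -> S \in D -> T \in D) ->
  exists2 h, composition_of F h &
    forall S, S \in D -> forall x, h (restrict S x) = f (restrict S x).
Proof.
move=> FC cf; have [k_gt0 _] := cf.
have [n] := ubnP #|D|; elim: n D => // n IH D; rewrite ltnS => leD ltK downD.
have [->|[S0 S0D]] := set_0Vmem D.
  have i0 : 'I_k by case: k k_gt0 => // n' _; exact: ord0.
  by exists [ffun x => tnth x i0]; [apply: Projection | move=> S; rewrite inE].
have [S SD maxS] : exists2 S, S \in D & forall R, R \in D -> #|R| <= #|S|.
  have [S SD maxS] := @arg_maxnP _ S0 (fun S => S \in D) (fun S => #|S|) S0D.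
  by exists S.
have maxSeq (R : {set 'I_k}) : R \in D -> S \subset R -> R = S.
  by move=> RD SR; apply/esym/eqP; rewrite eqEcard SR maxS.
have [||T R TR|h Fh hf] := IH (D :\ S).
- by move: leD; rewrite (cardsD1 S) SD.
- by move=> T /setD1P[_ /ltK].
- case/setD1P=> nR RD; rewrite !inE (downD _ _ TR RD) andbT.
  by apply: contraNneq nR => TS; apply/eqP/maxSeq; rewrite -?TS.
exists [ffun x => m (h x) ([ffun x => h (restrict S x)] x)
                          ([ffun x => f (restrict S x)] x)].
  apply: composition_malcev => //; apply: composition_restrict => //;
    by [apply: composition_of_Comp | apply: ltK].
move=> T TD x; rewrite !ffunE !restrictI.
have [->|nTS] := eqVneq T S; first by rewrite setIid (malcevl mP).
have STD : S :&: T \in D :\ S.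
  rewrite !inE (downD T) ?subsetIr // andbT.
  by apply: contraNneq nTS => /setIidPl /(maxSeq _ TD)/eqP.
by rewrite !hf ?(malcevr mP) // !inE nTS.
Qed.
End Span.
End Generation.

Lemma nonsplit_finitely_generated (A : finAlgebra) :
  has_malcev_term A -> ~ splits (congruence A) -> finitely_generated (Comp A).
Proof.
move=> /exists_malcev_op[m mP] /(absorbing_bounded mP)[K absK].
have [o _] : exists o : A, o \in A by apply/card_gt0P/carrier_gt0.
have [s sP] := Comp_list A K.+4; exists s; split=> k f; first by move=> /sP[].
pose F : opset A := fun k f => Tagged (operation A) f \in s.
move=> cf.
have FC n (g : operation A n) : F n g -> Comp A _ g by move=> /sP[].
have Fm : F 3 [ffun x : 3.-tuple A => m (tnth x 0%R) (tnth x 1%R) (tnth x 2%:R%R)].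
  apply/sP; split=> //; split=> // a x y xy; rewrite !ffunE.
  exact: (malcev_compatible mP).
have FK (g : operation A K.+1) : Comp A _ g -> F _ g.
  by move=> cg; apply/sP; split=> //; rewrite ltnS -(addn2 K.+1) leq_addr.
have [||h Fh hf] := @interpolate_small_supports A m mP o K F k Fm FK f
  [set S : {set _} | #|S| < K] FC cf.
- by move=> S; rewrite inE.
- by move=> S T TS; rewrite !inE; apply: leq_ltn_trans; apply: subset_leq_card.
suff -> : f = h by [].
have ch : Comp A _ h by apply: composition_of_Comp FC _ Fh; case: cf.
apply: (eq_small_support mP (o := o) absK cf ch) => S ltS x.
by rewrite hf // inE.
Qed.

(** * Additive functions on finite abelian groups *)

(** A quotient by a maximal normal subgroup has prime order p, so it is a line
    over F_p. *)
Lemma abelian_group_hom (gT : finGroupType) :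
  abelian [set: gT] -> [set: gT] != 1%g ->
  exists p (l : gT -> 'F_p), [/\ prime p,
    forall x y, l (x * y)%g = (l x + l y)%R & exists x, l x != 0%R].
Proof.
move=> abG ntG.
have [N maxN] := ex_maxnormal_ntrivg (G := [group of [set: gT]]) ntG.
have nN : [set: gT] \subset ('N(N))%g := normal_norm (maxnormal_normal maxN).
pose Q := ([set: gT] / N)%G; pose p := #|Q|.
have p_pr : prime p.
  by rewrite /p card_quotient // index_maxnormal_sol_prime // abelian_sol.
have abelQ : (p.-abelem Q)%g by apply: prime_abelem.
have ntQ : Q != 1%g :> {set _} by rewrite -cardG_gt1 prime_gt1.
have inQ x : coset N x \in Q by apply: mem_quotient; rewrite inE.
have inN x : x \in ('N(N))%g by apply: (subsetP nN); rewrite inE.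
pose v x := abelem_rV abelQ ntQ (coset N x).
have vM x y : v (x * y)%g = (v x + v y)%R.
  by rewrite /v morphM ?inN //; apply: abelem_rV_M; apply: inQ.
have v1 : v 1%g = 0%R by apply: (addrI (v 1%g)); rewrite -vM mulg1 addr0.
have [x vx] : exists x, v x != 0%R.
  have /trivgPn[q qQ nq] := ntQ; have /morphimP[x _ _ E] := qQ.
  exists x; apply: contraNneq nq => v0.
  have /(@abelem_rV_inj _ _ _ abelQ ntQ _ _ (inQ x) (inQ 1%g)) : v x = v 1%g.
    by rewrite v1.
  by rewrite E /= => ->; rewrite morph1.
have [j vj] : exists j, v x 0%R j != 0%R.
  apply: contrapT => none; case/eqP: vx; apply/rowP => j; rewrite mxE.
  by apply/eqP/contraT => nz; case: none; exists j.
exists p, (fun y => v y 0%R j); split=> // [y z|]; last by exists x.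
by rewrite vM mxE.
Qed.

Section LawGroup.
Variables (T : finType) (mul : T -> T -> T) (e : T) (inv : T -> T).

(** The group axioms are parameters of the type, so that the group structure on
    it can be inferred. *)
Definition law_group of associative mul & left_id e mul &
  left_inverse e inv mul : Type := T.

Hypotheses (mA : associative mul) (m1 : left_id e mul)
  (mV : left_inverse e inv mul).
Let gT := law_group mA m1 mV.
HB.instance Definition _ := Finite.on gT.
HB.instance Definition _ := Finite_isGroup.Build gT mA m1 mV.

Lemma abelian_law_hom : commutative mul -> (exists x, x != e) ->
  exists p (l : T -> 'F_p), [/\ prime p,
    forall x y, l (mul x y) = (l x + l y)%R & exists x, l x != 0%R].
Proof.
move=> mC [x nx]; apply: (@abelian_group_hom gT).
  by apply/centsP => y _ z _; apply: mC.
by apply/trivgPn; exists x; rewrite ?inE.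
Qed.
End LawGroup.

(** * Characters of central covers *)

Section Characters.
Variables (A : finAlgebra) (m : A -> A -> A -> A).
Hypothesis mP : malcev_op m.
Implicit Types a b c : congruence A.

(** An equation between f and g at three corners of a rectangle carries over to
    the fourth one modulo a: apply the term
    condition to z, s |-> m (f z s) (g z s) (g x u). *)
Lemma central_eq a b I (f g : (I -> A) -> A -> A) x y t u :
  central \top%O a b -> compatible2 f -> compatible2 g -> t ~[b] u ->
  f x t = g x t -> f y t = g y t -> f y u = g y u -> f x u ~[a] g x u.
Proof.
move=> cen cf cg tu Ext Eyt Eyu.
pose h z s := m (f z s) (g z s) (g x u).
have ch : compatible2 h.
  move=> d z z' s s' zz ss; apply: (malcev_compatible mP);
    [exact: cf | exact: cg | exact: cong_refl].
have := @cen I h ch y x t u (fun i => mem_top _ _) tu.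
rewrite /h Ext Eyt Eyu !(malcevl mP) (malcevr mP) => H.
exact/cong_sym/H/cong_refl.
Qed.

Variable R : fieldType.

(** In the central case the classes of b are, modulo a, parallel copies of one
    abelian group; chi is an affine function on each of them, with the same linear
    part. *)
Definition character a b (chi : A -> R) :=
  (forall x y, x ~[a] y -> chi x = chi y) /\
  (forall x y z, x ~[b] y -> chi (m x y z) = (chi x - chi y + chi z)%R).

Definition separated a b := forall x y, x ~[b] y -> ~ x ~[a] y ->
  exists2 chi, character a b chi & chi x != chi y.

(** Moving the argument t within its class changes the value by the same amount
    in all contexts x, by centrality. *)
Lemma character_increment a b chi I (f : (I -> A) -> A -> A) x y t u :
  central \top%O a b -> character a b chi -> compatible2 f -> t ~[b] u ->
  (chi (f x t) - chi (f x u) = chi (f y t) - chi (f y u))%R.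
Proof.
move=> cen [inv add] cf tu.
have fb z : f z t ~[b] f z u by apply: cf => // i; apply: cong_refl.
have /inv : m (f x u) (f x t) (f y t) ~[a] f y u.
  apply: (central_eq (f := fun z s => m (f z s) (f z t) (f y t))
    (g := fun _ s => f y s) (y := y) cen _ _ tu); rewrite ?(malcevl mP, malcevr mP) //.
    move=> d z z' s s' zz ss; apply: (malcev_compatible mP);
      by [apply: cf | apply: cf => //; apply: cong_refl | apply: cong_refl].
  by move=> d z z' s s' zz ss; apply: cf => // i; apply: cong_refl.
by rewrite (add _ _ _ (cong_sym (fb x))) => <-; ring.
Qed.

Definition compatible1 (g : A -> A) := forall a x y, x ~[a] y -> g x ~[a] g y.

Lemma character_comp a b chi g : central \top%O a b -> compatible1 g ->
  character a b chi -> character a b (chi \o g).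
Proof.
move=> cen cg [inv add]; split=> [x y /(cg a)/inv //|x y z xy /=].
rewrite -add ?cg //; apply: inv.
apply: (central_eq (I := unit) (f := fun z t => g (m t y (z tt)))
  (g := fun z t => m (g t) (g y) (g (z tt))) (x := fun=> z) (y := fun=> y)
  cen _ _ (cong_sym xy)); rewrite ?(malcevl mP, malcevr mP) //.
  move=> d v v' s s' zz ss; apply/cg/(malcev_compatible mP) => //.
  exact: cong_refl.
move=> d v v' s s' zz ss; apply: (malcev_compatible mP); apply: cg => //.
exact: cong_refl.
Qed.

(** Pass from y to x one coordinate at a time. *)
Lemma character_sum a b chi n (f : ('I_n -> A) -> A) (o : 'I_n -> A) x y :
  central \top%O a b -> character a b chi -> compatible f ->
  (forall i, x i ~[b] y i) ->
  (chi (f x) - chi (f y) = \sum_i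
    (chi (f (update o i (x i))) - chi (f (update o i (y i)))))%R.
Proof.
move=> cen cchi cf xy.
pose hyb j (i : 'I_n) := if i < j then x i else y i.
have Ex : x = hyb n by apply/funext => i; rewrite /hyb ltn_ord.
have E0 : y = hyb 0 by apply/funext.
rewrite {1}E0 {1}Ex -(@telescope_sumr _ 0 n (fun j => chi (f (hyb j)))) //.
rewrite big_mkord; apply: eq_bigr => i _.
have -> : hyb i.+1 = update (hyb i) i (x i).
  apply/funext => j; rewrite /hyb /update ltnS leq_eqVlt (val_eqE j i).
  by have [->|] := eqVneq j i.
have {2}-> : hyb i = update (hyb i) i (y i).
  apply/funext => j; rewrite /hyb /update.
  by have [->|//] := eqVneq j i; rewrite ltnn.
apply: (character_increment (f := fun z t => f (update z i t)) _ _ cen cchi _ (xy i)).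
by move=> d z z' s s' zz ss; apply: cf => j; rewrite /update; case: eqP.
Qed.

Lemma malcev_character a b chi x x' y y' z z' :
  central \top%O a b -> character a b chi ->
  x ~[b] x' -> y ~[b] y' -> z ~[b] z' ->
  (chi (m x y z) - chi (m x' y' z') =
   (chi x - chi x') - (chi y - chi y') + (chi z - chi z'))%R.
Proof.
move=> cen cchi xx yy zz.
pose arg (x y z : A) (i : 'I_3) := nth x [:: x; y; z] i.
pose f (v : 'I_3 -> A) := m (v 0%R) (v 1%R) (v 2%:R%R).
have cf : compatible f.
  by move=> c v v' vv; apply: (malcev_compatible mP).
have := character_sum (f := f) (fun=> y) (x := arg x y z) (y := arg x' y' z')
  cen cchi cf.
rewrite !big_ord_recl big_ord0 /f /arg /update /= => -> //.
  by rewrite !(malcevl mP) !(malcevr mP) addr0 cchi.2 //; ring.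
by case; case=> [|[|[]]].
Qed.

Lemma separated_down a b c d : transposed a b c d ->
  separated c d -> separated a b.
Proof.
move=> [<- <-] sep x y xy nxy.
have [||chi [inv add] nchi] := sep x y; first by apply: cong_le_mem xy; rewrite leUl.
  by apply: contra_not nxy => xy'; rewrite mem_meet xy.
exists chi => //; split=> [u v uv|u v w uv].
  by apply: inv; apply: cong_le_mem uv; rewrite leIr.
by apply: add; apply: cong_le_mem uv; rewrite leUl.
Qed.

(** A function on the classes of a is made invariant modulo c by measuring every
    x against a point w which lies in its class modulo b and is related modulo c
    to the representative of its class modulo d. *)
Lemma separated_up a b c d : central \top%O a b -> transposed a b c d ->
  separated a b -> separated c d.
Proof.
move=> cen [jE mE].
have bd : (b <= d)%O by rewrite -jE leUl.
have cd : (c <= d)%O by rewrite -jE leUr.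
have ac : (a <= c)%O by rewrite -mE leIr.
have /choice[w wP] x : exists w, x ~[b] w /\ w ~[c] rep d x.
  have /(mem_join mP)[w xw wx] : x ~[(b `|` c)%O] rep d x.
    by rewrite jE; apply: rep_cong.
  by exists w.
have ww x y : x ~[d] y -> w x ~[c] w y.
  move=> /rep_eq E; have [_ wx] := wP x; have [_ wy] := wP y.
  by apply: cong_trans wx _; rewrite E; apply: cong_sym.
pose p x y := m x (w x) (w y).
have pc x y : x ~[d] y -> p x y ~[c] x.
  move=> /ww wxy; rewrite -[X in _ ~[_] X](malcevr mP (w x)).
  by apply: (malcev_compatible mP); rewrite ?cong_refl //; apply: cong_sym.
have pb x y : p x y ~[b] y.
  have [xw _] := wP x; have [yw _] := wP y.
  apply: cong_trans (cong_sym yw); rewrite -[X in _ ~[_] X](malcevl mP (w x)).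
  by apply: (malcev_compatible mP); rewrite ?cong_refl.
have psi_p chi x y : character a b chi ->
    (chi (p x y) - chi y = (chi x - chi (w x)) - (chi y - chi (w y)))%R.
  by move=> [_ add]; rewrite /p add; [ring | have [] := wP x].
move=> sep x y xy nxy.
have [|chi cchi nchi] := sep _ _ (pb x y).
  apply: contra_not nxy => pxy; apply: cong_trans (cong_sym (pc x y xy)) _.
  exact: cong_le_mem pxy.
exists (fun x => chi x - chi (w x))%R; last first.
  by rewrite -subr_eq0 -psi_p // subr_eq0.
split=> [u v uv|u v z uv].
  apply/eqP; rewrite -subr_eq0 -psi_p // subr_eq0; apply/eqP/cchi.1.
  rewrite -mE mem_meet pb; apply: (cong_trans _ uv).
  by apply: pc; apply: cong_le_mem uv.
have [uw ws] := wP u; have [vw wv] := wP v; have [zw wz] := wP z.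
have dz : m u v z ~[d] z.
  rewrite -[X in _ ~[_] X](malcevl mP v).
  by apply: (malcev_compatible mP); rewrite ?cong_refl.
have -> : chi (w (m u v z)) = chi (m (w u) (w v) (w z)).
  apply: cchi.1; rewrite -mE mem_meet; apply/andP; split.
    have [h _] := wP (m u v z); apply: cong_trans (cong_sym h) _.
    exact: (malcev_compatible mP).
  apply: cong_trans (ww _ _ dz) _; apply: cong_sym.
  rewrite -[X in _ ~[_] X](malcevl mP (w v)).
  by apply: (malcev_compatible mP); rewrite ?cong_refl //; apply: ww.
by rewrite (malcev_character cen cchi uw vw zw); ring.
Qed.

(** The pairs in b that no character separates form a congruence between a and
    b, since precomposing a character with a unary map gives a character; by
    assumption it is not b. *)
Lemma covers_separated a b : covers a b -> central \top%O a b ->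
  (exists chi x y, [/\ character a b chi, x ~[b] y & chi x != chi y]) ->
  separated a b.
Proof.
move=> [ab alt] cen [chi0 [x0 [y0 [cchi0 xy0 nchi0]]]].
pose inseparable x y := forall chi, character a b chi -> chi x = chi y.
pose r : {set A * A} := [set p | (p \in cong_set b) && `[< inseparable p.1 p.2 >]].
have rP x y : reflect (x ~[b] y /\ inseparable x y) ((x, y) \in r).
  by rewrite inE; apply: (iffP andP) => -[? /asboolP].
have r_cong : is_congruence r.
  split=> [x y z|s x y xy].
    split=> [|/rP[xy exy]]; first by apply/rP; split=> //; apply: cong_refl.
    apply/rP/rP => -[xz exz]; split=> [|chi cchi].
    - exact: cong_trans (cong_sym xy) xz.
    - by rewrite -exy ?exz.
    - exact: cong_trans xy xz.
    - by rewrite exy ?exz.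
  have xyb i : tnth x i ~[b] tnth y i by have /rP[] := xy i.
  apply/rP; split=> [|chi cchi].
    by have [_ pres] := congruenceP b; apply: pres.
  pose f (v : 'I_(arity s) -> A) := basic s [tuple v i | i < arity s].
  have cf : compatible f.
    move=> c v v' vv; have [_ pres] := congruenceP c; apply: pres => i.
    by rewrite !tnth_mktuple.
  have fE (z : (arity s).-tuple A) : basic s z = f (tnth z).
    by congr (basic s _); apply: eq_from_tnth => i; rewrite tnth_mktuple.
  apply/eqP; rewrite -subr_eq0 !fE.
  rewrite (@character_sum _ _ _ _ f (tnth x) _ _ cen cchi cf xyb) big1 // => i _.
  have /rP[_ exy] := xy i; apply/eqP; rewrite subr_eq0; apply/eqP.
  apply: (exy (fun t => chi (f (update (tnth x) i t)))).
  apply: (@character_comp _ _ chi (fun t => f (update (tnth x) i t))) => //.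
  move=> c u v uv; apply: cf => j; rewrite /update; case: eqP => // _.
  exact: cong_refl.
pose q := Congruence (asboolT r_cong).
have [||qa|qb] := alt q.
- apply/subsetP => -[x y] xy; apply/rP; split=> [|chi [inv _]]; last exact: inv.
  exact: cong_le_mem (ltW ab) xy.
- by apply/subsetP => -[x y] /rP[].
- move=> x y xy nxy; apply: contrapT => none; apply: nxy; rewrite -qa.
  apply/rP; split=> // chi cchi; apply/eqP/contraT => nchi.
  by case: none; exists chi.
- have /rP[_ /(_ _ cchi0)] : (x0, y0) \in r by move: xy0; rewrite -[in X in X -> _]qb.
  by move/eqP; rewrite (negbTE nchi0).
Qed.

End Characters.

(** * Characters at the bottom of the lattice *)

Section Atom.
Variables (A : finAlgebra) (m : A -> A -> A -> A).
Hypothesis mP : malcev_op m.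
Variables (b : congruence A) (o : A).
Hypothesis cen : central \top%O \bot%O b.

Ltac compat := move=> ? ? ? ? ? ? ?;
  repeat first [apply: (malcev_compatible mP) | exact: cong_refl | done].

Lemma atom_eq I (f g : (I -> A) -> A -> A) x y t u :
  compatible2 f -> compatible2 g -> t ~[b] u ->
  f x t = g x t -> f y t = g y t -> f y u = g y u -> f x u = g x u.
Proof.
move=> cf cg tu E1 E2 E3.
by have := central_eq mP cen cf cg tu E1 E2 E3; rewrite mem_bot => /eqP.
Qed.

Let K := {x : A | x ~[b] o}.
Implicit Types x y z : K.

Lemma malcev_class (u v w : A) : u ~[b] v -> w ~[b] o -> m u v w ~[b] o.
Proof.
move=> uv wo; rewrite -[X in _ ~[_] X](malcevl mP v).
by apply: (malcev_compatible mP); rewrite ?cong_refl.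
Qed.

Let plus x y : K := exist _ (m (val x) o (val y)) (malcev_class (valP x) (valP y)).
Let zero : K := exist _ o (cong_refl b o).
Let opp x : K :=
  exist _ (m o (val x) o) (malcev_class (cong_sym (valP x)) (cong_refl b o)).

Let plusA : associative plus.
Proof.
move=> x y z; apply: val_inj => /=; apply/esym.
apply: (atom_eq (I := unit) (f := fun v t => m (m t o (v tt)) o (val z))
  (g := fun v t => m t o (m (v tt) o (val z))) (x := fun=> val y) (y := fun=> o)
  _ _ (cong_sym (valP x))); rewrite ?(malcevl mP, malcevr mP) //; compat.
Qed.

Let plusC : commutative plus.
Proof.
move=> x y; apply: val_inj => /=.
apply: (atom_eq (I := unit) (f := fun v t => m t o (v tt))
  (g := fun v t => m (v tt) o t) (x := fun=> val y) (y := fun=> o)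
  _ _ (cong_sym (valP x))); rewrite ?(malcevl mP, malcevr mP) //; compat.
Qed.

Let plus0 : left_id zero plus.
Proof. by move=> x; apply: val_inj; rewrite /= (malcevl mP). Qed.

Let plusN : left_inverse zero opp plus.
Proof.
move=> x; apply: val_inj => /=.
apply: (atom_eq (I := unit) (f := fun v t => m (m o t (v tt)) o t)
  (g := fun v t => v tt) (x := fun=> o) (y := fun=> val x)
  _ _ (cong_sym (valP x))); rewrite ?(malcevl mP, malcevr mP) //; compat.
Qed.

(* Translate the class of u to the class of o. *)
Let proj (u : A) : K := exist _ (m u (rep b u) o)
  (malcev_class (rep_cong b u) (cong_refl b o)).

Let proj_malcev (u v w : A) : u ~[b] v ->
  plus (proj (m u v w)) (proj v) = plus (proj u) (proj w).
Proof.
move=> uv; apply: val_inj => /=.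
have -> : rep b (m u v w) = rep b w.
  apply: rep_eq; rewrite -[X in _ ~[_] X](malcevl mP v).
  by apply: (malcev_compatible mP); rewrite ?cong_refl.
rewrite (rep_eq uv); set s := rep b w; set s' := rep b v.
pose arg (i : 'I_3) := nth w [:: w; s; s'] i.
have vE : m v s' o = val (proj v) by [].
have wE : m w s o = val (proj w) by [].
apply: (atom_eq (f := fun i t => m (m (m t v (i 0%R)) (i 1%R) o) o (m v (i 2%:R%R) o))
  (g := fun i t => m (m t (i 2%:R%R) o) o (m (i 0%R) (i 1%R) o))
  (x := arg) (y := fun=> v) _ _ (cong_sym uv));
  rewrite /arg /= ?(malcevl mP, malcevr mP) //.
- by compat.
- by compat.
- by rewrite vE wE; have /(congr1 val) := plusC (proj w) (proj v).
Qed.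

(** On the class of o, the operation m x o y is an abelian group law; a
    homomorphism from it to F_p is transported to the other classes by proj. *)
Lemma atom_character (e : A) : e ~[b] o -> e != o ->
  exists2 p, prime p & exists (chi : A -> 'F_p) (u v : A),
    [/\ character m \bot%O b chi, u ~[b] v & chi u != chi v].
Proof.
move=> eo neo.
have [|p [l [p_pr lD [k lk]]]] := abelian_law_hom plusA plus0 plusN plusC.
  by exists (exist _ e eo : K); apply: contraNneq neo => /(congr1 val) /= ->.
exists p => //; pose s := rep b o.
have os : o ~[b] s := rep_cong b o.
have l0 : l zero = 0%R by apply: (addrI (l zero)); rewrite -lD plus0 addr0.
have ks : m (val k) o s ~[b] s.
  rewrite -[X in _ ~[_] X](malcevl mP o).
  by apply: (malcev_compatible mP); rewrite ?cong_refl ?(valP k).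
exists (l \o proj), (m (val k) o s), s; split=> //.
  split=> [u v|u v w uv /=]; first by rewrite mem_bot => /eqP->.
  have := congr1 l (proj_malcev w uv); rewrite !lD => /eqP.
  by rewrite -subr_eq => /eqP <-; ring.
have -> : (l \o proj) s = 0%R.
  rewrite -l0 /=; congr l; apply: val_inj => /=.
  by rewrite -(rep_eq os) (malcevl mP).
suff -> : (l \o proj) (m (val k) o s) = l k by [].
rewrite /=; congr l; apply: val_inj => /=.
rewrite (rep_eq ks) -(rep_eq os) -/s.
apply: (atom_eq (I := unit) (f := fun v t => m (m t o (v tt)) (v tt) o)
  (g := fun v t => t) (x := fun=> s) (y := fun=> o)
  _ _ (cong_sym (valP k))); rewrite ?(malcevl mP, malcevr mP) //; compat.
Qed.

End Atom.

(** Separation by characters is invariant under transposition, so the prime of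
    a minimal congruence serves for all covers. *)
Lemma exists_separated (A : finAlgebra) (m : A -> A -> A -> A) :
  malcev_op m -> simple_lattice (congruence A) -> 2 < #|{: congruence A}| ->
  exists2 p, prime p & forall a b : congruence A, covers a b ->
    separated m 'F_p a b.
Proof.
move=> mP simpleL card_gt2.
have cen := simple_central mP simpleL card_gt2.
have [b cb _] : exists2 b : congruence A, covers \bot%O b & (b <= \top)%O.
  have [c [_ [nc _ _]]] := join_top simpleL card_gt2.
  apply: cover_above; rewrite lt0x; apply: contraNneq nc => T0.
  by apply/eqP/le_anti; rewrite lex1 T0 le0x.
have [lt0b _] := cb.
have [e [o [eo neo]]] : exists e o, e ~[b] o /\ e != o.
  apply: contrapT => none; suff : (b <= \bot)%O by rewrite lt_geF.
  apply/subsetP => -[e o] eo; rewrite mem_bot; apply/contraT => neo.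
  by case: none; exists e, o.
have [p p_pr [chi [u [v H]]]] := atom_character mP (cen _ _ cb) eo neo.
exists p => //.
apply: (@simple_projectively_invariant _ _ (congruences_modular mP)
  (separated m 'F_p) _ \bot%O b simpleL cb).
  move=> a1 b1 c1 d1 c1b T; split; last exact: separated_down.
  by apply: separated_up => //; apply: cen.
apply: (covers_separated mP cb (cen _ _ cb)).
by exists chi, u, v.
Qed.

(** * Sums of functions of few variables *)

Section Sparse.
Variables (T : finType) (R : comNzRingType).
Local Open Scope ring_scope.

Inductive sparse (d k : nat) : (k.-tuple T -> R) -> Prop :=
| SparseJunta (S : {set 'I_k}) h : (#|S| <= d)%N ->
    (forall x y, (forall i, i \in S -> tnth x i = tnth y i) -> h x = h y) ->
    sparse d h
| SparseAdd h1 h2 : sparse d h1 -> sparse d h2 ->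
    sparse d (fun x => h1 x + h2 x).

Lemma sparse_ext d k (h1 h2 : k.-tuple T -> R) :
  h1 =1 h2 -> sparse d h1 -> sparse d h2.
Proof. by move=> /funext->. Qed.

Lemma sparse_le d d' k (h : k.-tuple T -> R) :
  (d <= d')%N -> sparse d h -> sparse d' h.
Proof.
move=> le_d; elim=> [S h1 leS H|h1 h2 _ H1 _ H2]; last exact: SparseAdd.
by apply: (@SparseJunta _ _ S) => //; apply: leq_trans le_d.
Qed.

Lemma sparse_const d k (c : R) : @sparse d k (fun=> c).
Proof. by apply: (@SparseJunta _ _ set0); rewrite ?cards0. Qed.

Lemma sparse_mul d1 d2 k (h1 h2 : k.-tuple T -> R) :
  sparse d1 h1 -> sparse d2 h2 -> sparse (d1 + d2) (fun x => h1 x * h2 x).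
Proof.
move=> sp1 sp2; elim: sp1 => [S1 {}h1 le1 J1|u v _ Hu _ Hv]; last first.
  apply: sparse_ext (SparseAdd Hu Hv) => x; exact/esym/mulrDl.
elim: sp2 => [S2 {}h2 le2 J2|u v _ Hu _ Hv]; last first.
  apply: sparse_ext (SparseAdd Hu Hv) => x; exact/esym/mulrDr.
apply: (@SparseJunta _ _ (S1 :|: S2)).
  by apply: leq_trans (leq_card_setU _ _) _; apply: leq_add.
move=> x y xy; congr (_ * _); [apply: J1|apply: J2] => i iS; apply: xy;
  by rewrite inE iS ?orbT.
Qed.

Lemma sparse_sum d k (I : Type) (r : seq I) (h : I -> k.-tuple T -> R) :
  (forall i, sparse d (h i)) -> sparse d (fun x => \sum_(i <- r) h i x).
Proof.
move=> sp; elim: r => [|i r IH].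
  by apply: sparse_ext (sparse_const d _ 0) => x; rewrite big_nil.
by apply: sparse_ext (SparseAdd (sp i) IH) => x; rewrite big_cons.
Qed.

Lemma sparse_prod d k (I : Type) (r : seq I) (h : I -> k.-tuple T -> R) :
  (forall i, sparse d (h i)) -> sparse (size r * d) (fun x => \prod_(i <- r) h i x).
Proof.
move=> sp; elim: r => [|i r IH].
  by apply: sparse_ext (sparse_const _ _ 1) => x; rewrite big_nil.
by apply: sparse_ext (sparse_mul (sp i) IH) => x; rewrite big_cons.
Qed.

Definition vertex k (u v : T) (S : {set 'I_k}) : k.-tuple T :=
  [tuple if i \in S then v else u | i < k].

(** A function of fewer than k variables ignores a coordinate j, so that the
    vertices S and S + j of the cube cancel. *)
Lemma sparse_cube d k (u v : T) (h : k.-tuple T -> R) :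
  (d < k)%N -> sparse d h ->
  \sum_(S : {set 'I_k}) (-1) ^+ #|S| * h (vertex u v S) = 0.
Proof.
move=> ltk; elim=> [S0 h1 leS J|h1 h2 _ H1 _ H2]; last first.
  under eq_bigr do rewrite mulrDr.
  by rewrite big_split /= H1 H2 addr0.
have [j jS] : exists j, j \notin S0.
  have : (0 < #|~: S0|)%N.
    by rewrite -(ltn_add2l #|S0|) addn0 cardsC card_ord (leq_ltn_trans leS).
  by case/card_gt0P => j; rewrite inE; exists j.
rewrite (bigID (fun S : {set 'I_k} => j \in S)) /=.
rewrite (reindex_onto (fun S : {set 'I_k} => j |: S) (fun S => S :\ j)) /=; last first.
  by move=> S jS'; rewrite setD1K.
rewrite (eq_bigl (fun S : {set 'I_k} => j \notin S)); last first.
  move=> S; rewrite setU11 /=; apply/eqP/idP => [<-|jS']; first by rewrite !inE eqxx.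
  by rewrite setU1K.
rewrite -big_split big1 //= => S jS'.
rewrite cardsU1 jS' exprS (J (vertex u v (j |: S)) (vertex u v S)); first by ring.
move=> i iS; rewrite !tnth_mktuple !inE; case: eqP => //= E.
by rewrite -E iS in jS.
Qed.

End Sparse.

(** * Bounded degree of finitely generated clones *)

Section Bounded.
Variables (A : finAlgebra) (m : A -> A -> A -> A).
Hypothesis mP : malcev_op m.
Variables (R : fieldType) (F : opset A) (r : nat).
Hypothesis FC : forall k (f : operation A k), F f -> Comp A _ f.
Hypothesis Fr : forall k (f : operation A k), F f -> k <= r.
Implicit Types a b c : congruence A.
Local Open Scope ring_scope.

(** The degree d may depend on xi, but not on the arity of f. *)
Definition bounded (xi : A -> R) := exists d, forall k (f : operation A k),
  composition_of F f -> sparse d (fun x => xi (f x)).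

Lemma bounded_const z : bounded (fun=> z).
Proof. by exists 0%N => k f _; apply: sparse_const. Qed.

Lemma bounded_add xi zeta :
  bounded xi -> bounded zeta -> bounded (fun x => xi x + zeta x).
Proof.
move=> [d1 H1] [d2 H2]; exists (d1 + d2)%N => k f cf; apply: SparseAdd.
  by apply: sparse_le (H1 k f cf); rewrite leq_addr.
by apply: sparse_le (H2 k f cf); rewrite leq_addl.
Qed.

Lemma bounded_mul xi zeta :
  bounded xi -> bounded zeta -> bounded (fun x => xi x * zeta x).
Proof.
move=> [d1 H1] [d2 H2]; exists (d1 + d2)%N => k f cf.
exact: sparse_mul (H1 k f cf) (H2 k f cf).
Qed.

Lemma bounded_sum (I : Type) (s : seq I) (xi : I -> A -> R) :
  (forall i, bounded (xi i)) -> bounded (fun x => \sum_(i <- s) xi i x).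
Proof.
move=> H; elim: s => [|i s IH].
  have -> : (fun x => \sum_(i <- [::]) xi i x) = (fun=> 0).
    by apply/funext => x; rewrite big_nil.
  exact: bounded_const.
have -> : (fun x => \sum_(j <- i :: s) xi j x) =
    (fun x => xi i x + \sum_(j <- s) xi j x).
  by apply/funext => x; rewrite big_cons.
exact: bounded_add.
Qed.

Lemma bounded_prod (I : Type) (s : seq I) (xi : I -> A -> R) :
  (forall i, bounded (xi i)) -> bounded (fun x => \prod_(i <- s) xi i x).
Proof.
move=> H; elim: s => [|i s IH].
  have -> : (fun x => \prod_(i <- [::]) xi i x) = (fun=> 1).
    by apply/funext => x; rewrite big_nil.
  exact: bounded_const.
have -> : (fun x => \prod_(j <- i :: s) xi j x) =
    (fun x => xi i x * \prod_(j <- s) xi j x).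
  by apply/funext => x; rewrite big_cons.
exact: bounded_mul.
Qed.

Definition invariant_on a (xi : A -> R) := forall x y, x ~[a] y -> xi x = xi y.

Lemma uniform_bound (I : finType) (xi : I -> A -> R) :
  (forall i, bounded (xi i)) ->
  exists d, forall i k (f : operation A k), composition_of F f ->
    sparse d (fun x => xi i (f x)).
Proof.
move=> /choice[d H]; exists (\max_i d i)%N => i k f cf.
by apply: sparse_le (H i k f cf); apply: leq_bigmax.
Qed.

(** A function of n values in A/b is a polynomial in the indicator functions of
    the classes of b. *)
Lemma sparse_rep b d k n (q : ('I_n -> A) -> R) (h : 'I_n -> k.-tuple A -> A) :
  (forall i u, sparse d (fun x => (rep b (h i x) == u)%:R : R)) ->
  sparse (n * d) (fun x => q (fun i => rep b (h i x))).
Proof.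
move=> sp; pose g (v : {ffun 'I_n -> A}) (x : k.-tuple A) : R :=
  q v * \prod_(i <- enum 'I_n) (rep b (h i x) == v i)%:R.
apply: (@sparse_ext _ _ _ _ (fun x => \sum_(v <- enum {ffun 'I_n -> A}) g v x)).
  move=> x; rewrite big_enum /=.
  rewrite (bigD1 [ffun i => rep b (h i x)]) //= [X in _ + X]big1 ?addr0.
    rewrite /g big1 ?mulr1 => [|i _]; last by rewrite ffunE eqxx.
    by congr q; apply/funext => i; rewrite ffunE.
  move=> v nv; rewrite /g; suff [i ni] : exists i, rep b (h i x) != v i.
    by rewrite big_enum (bigD1 i) //= (negbTE ni) mul0r mulr0.
  apply: contrapT => none; case/eqP: nv; apply/ffunP => i; rewrite ffunE.
  by apply/esym/eqP/contraT => ni; case: none; exists i.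
apply: sparse_sum => v; rewrite /g -[X in sparse X _]add0n.
apply: sparse_mul; first exact: sparse_const.
rewrite -{1}(size_enum_ord n); apply: sparse_prod => i; exact: sp.
Qed.

(** The value of a character on a composition f(g_1, ..., g_n) is the sum of
    characters of the g_j and of a function of their classes modulo b, of which
    there are at most r. *)
Lemma bounded_character a b chi : central \top%O a b ->
  (forall xi, invariant_on b xi -> bounded xi) ->
  character m a b chi -> bounded chi.
Proof.
move=> cen Hb cchi.
have [D HD] : exists d, forall (u : A) k (f : operation A k), composition_of F f ->
    sparse d (fun x => (rep b (f x) == u)%:R : R).
  apply: (uniform_bound (xi := fun u y => (rep b y == u)%:R)) => u.
  by apply: Hb => x y /rep_eq ->.
exists (r * D + 1)%N => k f cf; elim: cf chi cchi => {f} [i|n f g Ff Fg IH] chi cchi.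
  apply: (@SparseJunta _ _ _ _ [set i]); first by rewrite cards1 leq_addl.
  by move=> x y /(_ i (set11 i)) E; rewrite !ffunE E.
have [_ pf] := FC Ff.
pose f' (v : 'I_n -> A) := f [tuple v i | i < n].
have cf' : compatible f'.
  by move=> c v v' vv; apply: pf => i; rewrite !tnth_mktuple.
have [o _] : exists o : A, o \in A by apply/card_gt0P/carrier_gt0.
pose chi' i t := chi (f' (update (fun=> o) i t)).
have cchi' i : character m a b (chi' i).
  apply: (character_comp mP (g := fun t => f' (update (fun=> o) i t)) cen _ cchi).
  move=> c u v uv; apply: cf' => j; rewrite /update; case: eqP => // _.
  exact: cong_refl.
pose q (v : 'I_n -> A) := chi (f' v) - \sum_(i <- enum 'I_n) chi' i (v i).
apply: (@sparse_ext _ _ _ _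
  (fun x => q (fun i => rep b (g i x)) + \sum_(i <- enum 'I_n) chi' i (g i x))).
  move=> x; rewrite !ffunE -[f _]/(f' (fun i => g i x)).
  have := character_sum mP (fun=> o) cen cchi cf'
    (x := fun i => g i x) (y := fun i => rep b (g i x)) (fun i => rep_cong b _).
  rewrite sumrB -/(chi' _ _) => /eqP; rewrite subr_eq => /eqP ->.
  by rewrite /q !big_enum /=; ring.
apply: SparseAdd; last first.
  by apply: sparse_sum => i; apply: IH.
apply: (@sparse_le _ _ (n * D)%N).
  by rewrite (leq_trans _ (leq_addr _ _)) // leq_mul2r (Fr Ff) orbT.
by apply: sparse_rep => i u; apply: HD.
Qed.

Hypothesis sep : forall a b, covers a b -> separated m R a b.
Hypothesis cen : forall a b, covers a b -> central \top%O a b.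

(** The bounded functions form an algebra. For a cover a < b it contains the
    characters and the functions on A/b, which together separate the classes of a,
    hence it contains all functions on A/a. *)
Lemma invariant_bounded a xi : invariant_on a xi -> bounded xi.
Proof.
have [n] := ubnP #|~: cong_set a|; elim: n a xi => // n IH a xi.
rewrite ltnS => le_n inv; have [aT|naT] := eqVneq a \top%O.
  have [o _] : exists o : A, o \in A by apply/card_gt0P/carrier_gt0.
  have -> : xi = fun=> xi o.
    by apply/funext => x; apply: inv; rewrite aT; apply: mem_top.
  exact: bounded_const.
have [|b cab _] := @cover_above _ _ a \top%O; first by rewrite ltx1.
have {}IH zeta : invariant_on b zeta -> bounded zeta.
  apply: IH; apply: leq_trans le_n; apply: proper_card.
  have [ab _] := cab; rewrite properE setCS -cong_leE (ltW ab) /=.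
  by rewrite setCS -cong_leE lt_geF.
have point u v : ~~ (u ~[a] v) ->
    exists zeta, [/\ bounded zeta, invariant_on a zeta, zeta u = 1 & zeta v = 0].
  move=> nuv; have [uv|nuv'] := boolP (u ~[b] v); last first.
    exists (fun x => (u ~[b] x)%:R); rewrite cong_refl (negbTE nuv'); split=> //.
      apply: IH => x y xy; congr (_%:R); congr nat_of_bool.
      by apply/idP/idP => h; apply: cong_trans h _ => //; apply: cong_sym.
    move=> x y /(cong_le_mem (coverW cab)) xy; congr (_%:R); congr nat_of_bool.
    by apply/idP/idP => h; apply: cong_trans h _ => //; apply: cong_sym.
  have [chi cchi nchi] := sep cab uv (elimN idP nuv).
  have nz : chi u - chi v != 0 by rewrite subr_eq0.
  exists (fun x => (chi u - chi v)^-1 * (chi x + - chi v)).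
  split; last 1 first.
  - by rewrite subrr mulr0.
  - apply: bounded_mul; first exact: bounded_const.
    apply: bounded_add; last exact: bounded_const.
    exact: bounded_character (cen cab) IH cchi.
  - by move=> x y /cchi.1->.
  - by rewrite mulVf.
have class_bounded u : bounded (fun x => (u ~[a] x)%:R).
  have /choice[zeta zP] v : exists zeta, [/\ bounded zeta, invariant_on a zeta,
      zeta u = 1 & ~~ (u ~[a] v) -> zeta v = 0].
    have [uv|/point[zeta [H1 H2 H3 H4]]] := boolP (u ~[a] v); last by exists zeta.
    by exists (fun=> 1); split=> //; apply: bounded_const.
  have -> : (fun x => (u ~[a] x)%:R) = (fun x => \prod_(v <- enum A) zeta v x).
    apply/funext => x; rewrite big_enum /=.
    have [ux|nux] := boolP (u ~[a] x).
      by rewrite big1 // => v _; have [_ zi <- _] := zP v; apply/esym/zi.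
    by rewrite (bigD1 x) //=; have [_ _ _ ->] := zP x; rewrite ?mul0r.
  by apply: bounded_prod => v; have [] := zP v.
have -> : xi = fun x => \sum_(u <- enum A)
    (xi u * (rep a u == u)%:R) * (u ~[a] x)%:R.
  apply/funext => x; rewrite big_enum /= (bigD1 (rep a x)) //= big1 ?addr0.
    rewrite -(rep_eq (rep_cong a x)) eqxx mulr1 cong_sym ?rep_cong // mulr1.
    exact/inv/rep_cong.
  move=> u nu; have [ux|_] := boolP (u ~[a] x); last by rewrite mulr0.
  by rewrite -(rep_eq ux) eq_sym in nu; rewrite (negbTE nu) mulr0 mul0r.
by apply: bounded_sum => u; apply: bounded_mul => //; apply: bounded_const.
Qed.

End Bounded.

(** A splitting pair provides functions of every arity that are constant on the
    classes of delta and take their values in one class of epsilon. *)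
Lemma split_not_finitely_generated (A : finAlgebra) : has_malcev_term A ->
  simple_lattice (congruence A) -> 2 < #|{: congruence A}| ->
  splits (congruence A) -> ~ finitely_generated (Comp A).
Proof.
move=> /exists_malcev_op[m mP] simpleL card_gt2 [delta [eps [dT eps0 split]]].
move=> [s [sC sG]].
pose F : opset A := fun k f => Tagged (operation A) f \in s.
have [p p_pr sep] := exists_separated mP simpleL card_gt2.
have cen := simple_central mP simpleL card_gt2.
pose r := \max_(q <- s) tag q.
have Fr k (f : operation A k) : F k f -> k <= r.
  move=> Ff; exact: (leq_bigmax_seq (F := @tag _ _) _ Ff).
have [e [o [eo neo]]] : exists e o, e ~[eps] o /\ e != o.
  apply: contrapT => none; suff : (eps <= \bot)%O by rewrite lt_geF.
  apply/subsetP => -[e o] eo; rewrite mem_bot; apply/contraT => neo.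
  by case: none; exists e, o.
have [v nvo] : exists v, ~~ (v ~[delta] o).
  apply: contrapT => none; suff : (\top <= delta)%O by rewrite lt_geF.
  have rel v : v ~[delta] o by apply/contraT => nv; case: none; exists v.
  by apply/subsetP => -[u v] _; apply: cong_trans (rel u) (cong_sym (rel v)).
pose f k : operation A k :=
  [ffun x => if [exists i, tnth x i ~[delta] o] then o else e].
have fC k : 0 < k -> Comp A k (f k).
  move=> k_gt0; split=> // a x y xy; rewrite !ffunE.
  have [ad|ea] := split a.
    suff -> : [exists i, tnth x i ~[delta] o] = [exists i, tnth y i ~[delta] o].
      exact: cong_refl.
    apply/existsP/existsP => -[i io]; exists i; apply: cong_trans io.
      exact/cong_sym/(cong_le_mem ad).
    exact: cong_le_mem ad _.
  by do 2 case: ifP => _; rewrite ?cong_refl // ?(cong_le_mem ea) // cong_sym.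
have [|d Hd] := @invariant_bounded A m mP 'F_p F r sC Fr sep cen \bot%O
  (fun x => (x == e)%:R%R); first by move=> x y; rewrite mem_bot => /eqP->.
have := sparse_cube o v (ltnSn d) (Hd d.+1 (f d.+1) (sG _ _ (fC _ (ltn0Sn d)))).
rewrite (bigD1 [set: 'I_d.+1]) //= big1 => [|S nS].
  rewrite addr0 ffunE; case: existsP => [[i]|_].
    by rewrite tnth_mktuple inE (negbTE nvo).
  rewrite eqxx mulr1 => /eqP.
  by rewrite signr_eq0.
have [i niS] : exists i, i \notin S.
  apply: contrapT => none; case/eqP: nS; apply/setP => i; rewrite inE.
  by apply/contraT => niS; case: none; exists i.
rewrite ffunE; case: existsP => [_|[]]; first by rewrite eq_sym (negbTE neo) mulr0.
by exists i; rewrite tnth_mktuple (negbTE niS) cong_refl.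
Qed.

Theorem theorem2p6 (A : finAlgebra) (malcevA : has_malcev_term A)
    (simpleL : simple_lattice (congruence A)) :
  finitely_generated (Comp A) <->
  (~ splits (congruence A)) \/ #|{: congruence A}| <= 2.
Proof.
split=> [fg|[nsplit|le2]].
- have [le2|gt2] := leqP #|{: congruence A}| 2; first by right.
  by left=> spl; apply: split_not_finitely_generated fg.
- exact: nonsplit_finitely_generated.
- exact: small_lattice_finitely_generated.
Qed.
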